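(* Let $A$ and $B$ be systems of qubits, let $N\in\mathbb{N}$, let $A_1,\dots,A_N$ be qubits of $A$ and $B_1,\dots,B_N$ qubits of $B$. Let $U^{(i)}_{A_i,B_i}$, $i=1,\dots,N$, be two-qubit unitaries acting on the indicated qubits, with KAK parameters $(u^{(i)}_k)_{k=0}^3$. Then the unitaries $\{U^{(i)}_{A_i,B_i}\}_{i=1}^N$ have a decomposition that is independent of the interleaving black box channels, with optimal black box overhead $$\overline{\gamma}_{\mathrm{LOCC}}\big(\{U^{(i)}_{A_i,B_i}\}_{i=1}^N\big)=\overline{\gamma}_{\mathrm{LO}}\big(\{U^{(i)}_{A_i,B_i}\}_{i=1}^N\big)=1+2\sum_{\mathbf{k}\neq\mathbf{k}'}|w_{\mathbf{k}}|\,|w_{\mathbf{k}'}| ,$$ where the sum is over all ordered pairs of distinct $\mathbf{k},\mathbf{k}'\in\{0,1,2,3\}^N$ and $w_{\mathbf{k}}=\prod_{i=1}^Nu^{(i)}_{k_i}$.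
   Context: All Hilbert spaces are finite-dimensional. $\mathrm{CPTP}(X)$ is the set of completely positive trace-preserving maps on system $X$. KAK parameters: every two-qubit unitary $U$ can be written as $U=(V_1\otimes V_2)\big(\sum_{k=0}^3 u_k\,\sigma_k\otimes\sigma_k\big)(V_3\otimes V_4)$ with single-qubit unitaries $V_1,\dots,V_4$, $\sigma_0$ the identity matrix, $\sigma_1,\sigma_2,\sigma_3$ the Pauli matrices $X,Y,Z$, and $u_k\in\mathbb{C}$ with $\sum_k|u_k|^2=1$. The $u_k$ are called the KAK parameters of $U$. Local operations: $\mathcal{N}(X)=\{\mathcal{A}^+-\mathcal{A}^-:\ \mathcal{A}^\pm \text{ completely positive},\ \mathcal{A}^++\mathcal{A}^-\in\mathrm{CPTP}(X)\}$ and $\mathrm{LO}(A,B)=\{\mathcal{F}_A\otimes\mathcal{F}_B:\ \mathcal{F}_A\in\mathcal{N}(A),\ \mathcal{F}_B\in\mathcal{N}(B)\}$. LOCC: an instrument is a finite family $(\mathcal{E}_i)$ of completely positive maps whose sum is trace preserving. A one-way local instrument from $A$ has the form $(\mathcal{E}_i\otimes\mathcal{T}_i)_i$ with $(\mathcal{E}_i)$ an instrument on $A$ and each $\mathcal{T}_i$ CPTP on $B$ (analogously from $B$). An LOCC instrument is obtained by finitely many rounds, in each of which a one-way local instrument (from $A$ or from $B$, possibly changing the local finite dimensions) is applied that may depend on all previous outcomes, followed by coarse-graining (summing) of outcomes. $\mathrm{LOCC}(A,B)$ is the set of maps $\sum_i s_i\mathcal{E}_i$ on $AB$ with $(\mathcal{E}_i)$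 an LOCC instrument and $s_i\in\{+1,-1\}$. Black box $\gamma$-factor: for channels $\mathcal{E}^{(1)}_{AB},\dots,\mathcal{E}^{(N)}_{AB}$ and $S\in\{\mathrm{LO},\mathrm{LOCC}\}$, $\overline{\gamma}_S(\{\mathcal{E}^{(j)}_{AB}\}_j)$ is the minimum of $\sum_{i=1}^m|a_i|$ over all finite-dimensional ancillary systems $E_A,E_B$, all $m\ge1$, $a_i\in\mathbb{R}$ and $\mathcal{F}^{(j)}_i\in S(AE_A,BE_B)$ such that, simultaneously for all $X^{(1)}_{AB},\dots,X^{(N)}_{AB}\in\mathrm{CPTP}(AB)$ (the black box channels), $$\prod_{j=1}^N X^{(j)}_{AB}\circ\mathcal{E}^{(j)}_{AB}=\mathrm{tr}_{E_AE_B}\sum_{i=1}^m a_i\Big(\prod_{j=1}^N X^{(j)}_{AB}\circ\mathcal{F}^{(j)}_i\Big).$$ Products denote composition, in the same order on both sides. On the right, each $X^{(j)}_{AB}$ acts as the identity on $E_AE_B$, and the ancillas $E_A,E_B$ are initialized in a fixed product state $|0\rangle_{E_A}|0\rangle_{E_B}$, so both sides are maps on $AB$. The $a_i,\mathcal{F}^{(j)}_i$ may not depend on the $X^{(j)}_{AB}$. For unitaries, $\overline{\gamma}_S(\{U^{(i)}\}_i)$ refers to the channels $\rho\mapsto U^{(i)}\rho U^{(i)\dagger}$, where a unitary on a subset of the qubits acts as the identity on the others. *)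

(* Defs.v *)
(* MathComp world; the complex numbers are R[i] (mathcomp-real-closed) over a
   realType R, and tensor products of matrices are the Kronecker products *t of
   mxtens, i.e. the basis of H (x) K is enumerated by mxtens_index. *)
From HB Require Import structures.
From mathcomp Require Import all_boot all_order all_algebra.
From mathcomp Require Import reals.
From mathcomp Require Export complex mxtens.

Set Implicit Arguments.
Unset Strict Implicit.
Unset Printing Implicit Defensive.

Import Order.TTheory GRing.Theory Num.Theory.
Local Open Scope ring_scope.
Local Open Scope complex_scope.
Local Open Scope sesquilinear_scope.

Section Maps.
Variable R : realType.
Local Notation C := R[i].

Definition psdmx n (M : 'M[C]_n) : Prop :=
  forall v : 'rV[C]_n, 0 <= (v *m M *m v ^t*) 0 0.

(* The linear map F (x) G, given by its values on matrix units:
   (F (x) G) (E_ij (x) E_kl) = F E_ij (x) G E_kl. *)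
Definition tensmap m n p q (F : 'M[C]_m -> 'M[C]_p) (G : 'M[C]_n -> 'M[C]_q)
    (rho : 'M[C]_(m * n)) : 'M[C]_(p * q) :=
  \sum_i \sum_j rho i j *:
    (F (delta_mx (mxtens_unindex i).1 (mxtens_unindex j).1) *t
     G (delta_mx (mxtens_unindex i).2 (mxtens_unindex j).2)).

Definition is_cp m n (F : 'M[C]_m -> 'M[C]_n) : Prop :=
  linear F /\
  forall k (rho : 'M[C]_(k * m)), psdmx rho -> psdmx (tensmap id F rho).

Definition is_tp m n (F : 'M[C]_m -> 'M[C]_n) : Prop :=
  forall rho, \tr (F rho) = \tr rho.

Definition is_cptp m n (F : 'M[C]_m -> 'M[C]_n) : Prop := is_cp F /\ is_tp F.

Definition conj_channel n (U rho : 'M[C]_n) : 'M[C]_n := U *m rho *m U ^t*.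

Definition signed_op n (F : 'M[C]_n -> 'M[C]_n) : Prop :=
  exists Ap Am : 'M[C]_n -> 'M[C]_n,
    [/\ is_cp Ap, is_cp Am, is_cptp (Ap \+ Am) & F =1 (Ap \- Am)].

Definition LO m n (F : 'M[C]_(m * n) -> 'M[C]_(m * n)) : Prop :=
  exists FA FB, [/\ signed_op FA, signed_op FB & F =1 tensmap FA FB].

Definition is_instrument m p (I : finType) (E : I -> 'M[C]_m -> 'M[C]_p) :
    Prop :=
  (forall i, is_cp (E i)) /\ is_tp (fun rho => \sum_i E i rho).

Definition one_way m n p q (I : finType)
    (G : I -> 'M[C]_(m * n) -> 'M[C]_(p * q)) : Prop :=
  (exists (E : I -> 'M[C]_m -> 'M[C]_p) (T : I -> 'M[C]_n -> 'M[C]_q),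
     [/\ is_instrument E, forall i, is_cptp (T i)
       & forall i, G i =1 tensmap (E i) (T i)]) \/
  (exists (T : I -> 'M[C]_m -> 'M[C]_p) (E : I -> 'M[C]_n -> 'M[C]_q),
     [/\ is_instrument E, forall i, is_cptp (T i)
       & forall i, G i =1 tensmap (T i) (E i)]).

(* The index type records the full history of outcomes; the instrument G i of
   a new round, its kind (from A or from B) and its outcome set J i may all
   depend on that history i. *)
Inductive locc_rounds m n : forall p q (I : finType),
    (I -> 'M[C]_(m * n) -> 'M[C]_(p * q)) -> Prop :=
| locc_start : @locc_rounds m n m n unit (fun=> id)
| locc_round p q (I : finType) (E : I -> 'M[C]_(m * n) -> 'M[C]_(p * q))
    r s (J : I -> finType)
    (G : forall i, J i -> 'M[C]_(p * q) -> 'M[C]_(r * s)) :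
    locc_rounds E -> (forall i, one_way (@G i)) ->
    @locc_rounds m n r s {i : I & J i}
      (fun k => G (tag k) (tagged k) \o E (tag k)).

Definition locc_instrument m n p q (K : finType)
    (E : K -> 'M[C]_(m * n) -> 'M[C]_(p * q)) : Prop :=
  exists (I : finType) (E0 : I -> 'M[C]_(m * n) -> 'M[C]_(p * q)) (f : I -> K),
    locc_rounds E0 /\ forall k rho, E k rho = \sum_(i | f i == k) E0 i rho.

Definition LOCC m n (F : 'M[C]_(m * n) -> 'M[C]_(m * n)) : Prop :=
  exists (K : finType) (E : K -> 'M[C]_(m * n) -> 'M[C]_(m * n)) (s : K -> bool),
    locc_instrument E /\ forall rho, F rho = \sum_k (-1) ^+ s k *: E k rho.

End Maps.

(* Identification of (H1 (x) H2) (x) (H3 (x) H4) with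
   (H1 (x) H3) (x) (H2 (x) H4), on basis indices and on operators. *)
Definition swap_mid m n p q (i : 'I_((m * n) * (p * q))) :
    'I_((m * p) * (n * q)) :=
  let x := mxtens_unindex (mxtens_unindex i).1 in
  let y := mxtens_unindex (mxtens_unindex i).2 in
  mxtens_index (mxtens_index (x.1, y.1), mxtens_index (x.2, y.2)).

Definition reorder (T : Type) m n p q (M : 'M[T]_((m * n) * (p * q))) :
    'M[T]_((m * p) * (n * q)) :=
  mxsub (@swap_mid m p n q) (@swap_mid m p n q) M.

Section BlackBox.
Variable R : realType.
Local Notation C := R[i].

Definition ptrace2 m n (rho : 'M[C]_(m * n)) : 'M[C]_m :=
  \matrix_(i, j) \sum_k rho (mxtens_index (i, k)) (mxtens_index (j, k)).

(* A map on AB, extended by the identity of E_A E_B to the bipartite system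
   (A E_A) (x) (B E_B). *)
Definition on_AB dA dB eA eB (X : 'M[C]_(dA * dB) -> 'M[C]_(dA * dB))
    (rho : 'M[C]_((dA * eA) * (dB * eB))) : 'M[C]_((dA * eA) * (dB * eB)) :=
  reorder (tensmap X id (reorder rho)).

(* The dimensions of the ancillas are eA.+1 and eB.+1, hence nonzero. *)
Definition init_anc dA dB eA eB (rho : 'M[C]_(dA * dB)) :
    'M[C]_((dA * eA.+1) * (dB * eB.+1)) :=
  reorder (rho *t (delta_mx 0 0 *t delta_mx 0 0)).

Definition trace_anc dA dB eA eB (rho : 'M[C]_((dA * eA) * (dB * eB))) :
    'M[C]_(dA * dB) := ptrace2 (reorder rho).

(* f_0 \o (f_1 \o (... \o f_(N-1))) *)
Definition compose (T : Type) N (f : 'I_N -> T -> T) : T -> T :=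
  \big[(fun g h : T -> T => g \o h)/id]_(j < N) f j.

Definition bb_decomposition
    (S : forall m n, ('M[C]_(m * n) -> 'M[C]_(m * n)) -> Prop)
    dA dB N (E : 'I_N -> 'M[C]_(dA * dB) -> 'M[C]_(dA * dB))
    eA eB m (a : 'I_m -> R)
    (F : 'I_m -> 'I_N -> 'M[C]_((dA * eA.+1) * (dB * eB.+1)) ->
                         'M[C]_((dA * eA.+1) * (dB * eB.+1))) : Prop :=
  [/\ (0 < m)%N, forall i j, S (dA * eA.+1)%N (dB * eB.+1)%N (F i j)
    & forall X : 'I_N -> 'M[C]_(dA * dB) -> 'M[C]_(dA * dB),
        (forall j, is_cptp (X j)) ->
      forall rho,
        compose (fun j => X j \o E j) rho =
        trace_anc (\sum_(i < m) (a i)%:C *: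
          compose (fun j => on_AB (X j) \o F i j) (init_anc eA eB rho))].

(* v is the minimum (attained, hence unique) defining the black box
   gamma-factor of the family E with respect to S. *)
Definition is_bb_gamma
    (S : forall m n, ('M[C]_(m * n) -> 'M[C]_(m * n)) -> Prop)
    dA dB N (E : 'I_N -> 'M[C]_(dA * dB) -> 'M[C]_(dA * dB)) (v : R) : Prop :=
  (exists eA eB m (a : 'I_m -> R) F,
     @bb_decomposition S dA dB N E eA eB m a F /\ \sum_i `|a i| = v) /\
  (forall eA eB m (a : 'I_m -> R) F,
     @bb_decomposition S dA dB N E eA eB m a F -> v <= \sum_i `|a i|).

End BlackBox.

Section Qubits.
Variable R : realType.
Local Notation C := R[i].

(* The computational basis of n qubits is enumerated by bit strings. *)
Definition qdim n : nat := #|{ffun 'I_n -> 'I_2}|.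

Definition bits n (i : 'I_(qdim n)) : {ffun 'I_n -> 'I_2} := enum_val i.

(* U acting on qubit a of A and qubit b of B, and as the identity on all other
   qubits. *)
Definition gate_on nA nB (a : 'I_nA) (b : 'I_nB) (U : 'M[C]_(2 * 2)) :
    'M[C]_(qdim nA * qdim nB) :=
  \matrix_(i, j)
    let x := bits (mxtens_unindex i).1 in let y := bits (mxtens_unindex i).2 in
    let x' := bits (mxtens_unindex j).1 in let y' := bits (mxtens_unindex j).2 in
    if [forall k, (k != a) ==> (x k == x' k)] &&
       [forall k, (k != b) ==> (y k == y' k)]
    then U (mxtens_index (x a, y b)) (mxtens_index (x' a, y' b)) else 0.

Definition pauliX : 'M[C]_2 := \matrix_(i, j) (i != j)%:R.
Definition pauliY : 'M[C]_2 :=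
  \matrix_(i, j) if i == j then 0 else if i == 0 then 0 -i* 1 else 0 +i* 1.
Definition pauliZ : 'M[C]_2 := \matrix_(i, j) ((-1) ^+ i *+ (i == j)).

Definition pauli (k : 'I_4) : 'M[C]_2 :=
  nth 0 [:: 1%:M; pauliX; pauliY; pauliZ] k.

Definition is_KAK (U : 'M[C]_(2 * 2)) (u : 'I_4 -> C) : Prop :=
  \sum_k Normc.normc (u k) ^+ 2 = 1 /\
  exists V1 V2 V3 V4 : 'M[C]_2,
    [/\ V1 \is unitarymx, V2 \is unitarymx, V3 \is unitarymx,
        V4 \is unitarymx
      & U = (V1 *t V2) *m (\sum_k u k *: (pauli k *t pauli k)) *m (V3 *t V4)].

End Qubits.

(* Main.v *)
From HB Require Import structures.
Require Import Defs.
From mathcomp Require Import all_boot all_order all_fingroup all_algebra.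
From mathcomp Require Import reals ring lra.
Set Implicit Arguments.
Unset Strict Implicit.
Unset Printing Implicit Defensive.
Import Order.TTheory GRing.Theory Num.Theory.
Local Open Scope ring_scope.
Local Open Scope complex_scope.
Local Open Scope sesquilinear_scope.

(* Lower bound.  Tensor products of completely positive maps have product Kraus
   operators (Choi), so every LOCC map with signs is a difference P - M of
   separable maps with P + M trace preserving, and so is every term of a black
   box decomposition when the black boxes are local unitaries.  Choose these so
   that they cancel the local unitaries of the gates and move each gate to fresh
   qubits: the circuit becomes the unitary sum_k |w_k| S_k (x) T_k, where the
   S_k, and the T_k, are orthogonal in the Hilbert-Schmidt inner product.  The
   overlap of a map with Theta = sum_k S_k (x) T_k is at most d * tr(P(1)) on a
   separable map P on dimension d (Bessel and Cauchy-Schwarz), but equals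
   d^2 (sum_k |w_k|)^2 on the circuit.  This gives
   2 (sum_k |w_k|)^2 <= 1 + sum_i |a_i|.

   Upper bound.  Expand every gate over Pauli strings.  For each pair (k, k')
   an ancilla qubit on either side is put in an equal superposition of two
   states that control whether the string k or k' is applied; the final
   measurement of X (x) X, minus that of Y (x) Y, of the two ancillas isolates
   the interference of the branches k and k', whatever the black boxes are. *)

(** * Adjoints and tensor products of matrices *)

(** The overlap bound alone would only give (sum_k |w_k|)^2 <= sum_i |a_i|. The sharper constant
    comes from trace preservation: in a term a (P - M) only one of the two maps helps the overlap,
    and tr P(1) + tr M(1) = d, so |a| times the helpful trace is half of |a| d + a tr((P - M)(1)).
    Summed over all terms, the second part is the trace of the circuit at the identity, that is d;
    this is the summand 1. Since sum_k |w_k|^2 = 1, the bound 2 (sum_k |w_k|)^2 - 1 is exactly the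
    claimed value. Fresh qubits are needed for orthogonality: on a shared qubit, products of Pauli
    matrices belonging to different strings can be proportional. In the upper bound, X (x) X also
    retains the two terms in which A and B follow opposite strings. Y (x) Y gives these the same
    sign and the wanted terms the opposite sign, so the difference removes them. A pair of distinct
    strings thus costs 2 |w_k| |w_k'|, whereas for k = k' all terms agree and X (x) X alone
    suffices, at cost |w_k|^2. *)

Section Adjoint.
Variable C : numClosedFieldType.

Lemma adjmxM m n p (A : 'M[C]_(m, n)) (B : 'M[C]_(n, p)) :
  (A *m B)^t* = B^t* *m A^t*.
Proof. by rewrite trmx_mul map_mxM. Qed.

Lemma adjmxK m n (A : 'M[C]_(m, n)) : (A^t*)^t* = A.
Proof. by apply/matrixP => i j; rewrite !mxE conjCK. Qed.

Lemma adjmxD m n (A B : 'M[C]_(m, n)) : (A + B)^t* = A^t* + B^t*.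
Proof. by rewrite linearD map_mxD. Qed.

Lemma adjmxZ m n c (A : 'M[C]_(m, n)) : (c *: A)^t* = c^*%R *: A^t*.
Proof. by rewrite linearZ map_mxZ. Qed.

Lemma adjmx_sum m n (I : Type) (r : seq I) (P : pred I) (A : I -> 'M[C]_(m, n)) :
  (\sum_(i <- r | P i) A i)^t* = \sum_(i <- r | P i) (A i)^t*.
Proof. by rewrite linear_sum map_mx_sum. Qed.

Lemma adjmxE m n (A : 'M[C]_(m, n)) i j : A^t* i j = (A j i)^*%R.
Proof. by rewrite !mxE. Qed.

Lemma adjmx1 n : (1%:M : 'M[C]_n)^t* = 1%:M.
Proof. by rewrite trmx1 map_mx1. Qed.

Lemma adjmx_tens m n p q (A : 'M[C]_(m, n)) (B : 'M[C]_(p, q)) :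
  (A *t B)^t* = A^t* *t B^t*.
Proof. by rewrite trmx_tens map_mxT. Qed.

Lemma unitarymx_adjmxM n (A : 'M[C]_n) : A \is unitarymx -> A^t* *m A = 1%:M.
Proof. by rewrite -trmxC_unitary => /unitarymxP; rewrite adjmxK. Qed.

End Adjoint.

Lemma linear_packed (R : pzRingType) (U V : lmodType R) (f : U -> V) :
  linear f -> exists f' : {linear U -> V}, f = f'.
Proof.
move=> lin_f; pose f' := GRing.isLinear.Build _ _ _ _ f lin_f.
pose F : {linear U -> V} := HB.pack f f'.
by exists F.
Qed.

Lemma linear_comp (R : pzRingType) (U V W : lmodType R) (f : V -> W) (g : U -> V) :
  linear f -> linear g -> linear (f \o g).
Proof. by move=> lin_f lin_g c x y; rewrite /= lin_g lin_f. Qed.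

Lemma linear_sumf (R : comPzRingType) (U V : lmodType R) (I : Type) (r : seq I)
    (P : pred I) (f : I -> U -> V) :
  (forall i, linear (f i)) -> linear (fun x => \sum_(i <- r | P i) f i x).
Proof.
move=> lin_f c x y; rewrite scaler_sumr -big_split.
by apply: eq_bigr => i _; rewrite lin_f.
Qed.

Lemma mxtrace_linear (R : pzRingType) n :
  linear (mxtrace : 'M[R]_n -> R^o).
Proof. by move=> c x y; rewrite mxtraceD mxtraceZ. Qed.

Section Tensor.
Variable R : comPzRingType.

Lemma tensmxDl m n p q (A A' : 'M[R]_(m, n)) (B : 'M[R]_(p, q)) :
  (A + A') *t B = A *t B + A' *t B.
Proof. by apply/matrixP => i j; rewrite !mxE mulrDl. Qed.

Lemma tensmxDr m n p q (A : 'M[R]_(m, n)) (B B' : 'M[R]_(p, q)) :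
  A *t (B + B') = A *t B + A *t B'.
Proof. by apply/matrixP => i j; rewrite !mxE mulrDr. Qed.

Lemma tensmxZl m n p q c (A : 'M[R]_(m, n)) (B : 'M[R]_(p, q)) :
  (c *: A) *t B = c *: (A *t B).
Proof. by apply/matrixP => i j; rewrite !mxE mulrA. Qed.

Lemma tensmxZr m n p q c (A : 'M[R]_(m, n)) (B : 'M[R]_(p, q)) :
  A *t (c *: B) = c *: (A *t B).
Proof. by apply/matrixP => i j; rewrite !mxE mulrCA. Qed.

Lemma tensmx_suml m n p q (I : Type) (r : seq I) (P : pred I)
    (A : I -> 'M[R]_(m, n)) (B : 'M[R]_(p, q)) :
  (\sum_(i <- r | P i) A i) *t B = \sum_(i <- r | P i) (A i *t B).
Proof.
by apply: (big_morph (fun X => X *t B)) => [X Y|];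
  rewrite (tensmxDl, tens0mx).
Qed.

Lemma tensmx_sumr m n p q (I : Type) (r : seq I) (P : pred I)
    (A : 'M[R]_(m, n)) (B : I -> 'M[R]_(p, q)) :
  A *t (\sum_(i <- r | P i) B i) = \sum_(i <- r | P i) (A *t B i).
Proof.
by apply: (big_morph (fun X => A *t X)) => [X Y|];
  rewrite (tensmxDr, tensmx0).
Qed.

Lemma tensmx11 m n : (1%:M : 'M[R]_m) *t (1%:M : 'M[R]_n) = 1%:M.
Proof.
apply/matrixP => i j; rewrite !mxE -natrM mulnb.
by rewrite -xpair_eqE -!surjective_pairing (can_eq (@mxtens_unindexK _ _)).
Qed.

Lemma mxtrace_tens m n (A : 'M[R]_m) (B : 'M[R]_n) :
  \tr (A *t B) = \tr A * \tr B.
Proof. by rewrite mulr_sum; apply: eq_bigr => i _; rewrite !mxE. Qed.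

Lemma delta_tens m n p q (i : 'I_m) (j : 'I_n) (k : 'I_p) (l : 'I_q) :
  (delta_mx i j : 'M[R]_(m, n)) *t (delta_mx k l : 'M[R]_(p, q)) =
  delta_mx (mxtens_index (i, k)) (mxtens_index (j, l)).
Proof.
apply/matrixP => x y; case: (mxtens_indexP x) => x1 x2.
case: (mxtens_indexP y) => y1 y2; rewrite tensmxE !mxE -natrM mulnb.
by rewrite !(can_eq (@mxtens_indexK _ _)) !xpair_eqE andbACA.
Qed.

(** Matrix units of the product are products of matrix units, so linear maps can be compared on
    product operators; this hides the matrix-unit definition of [tensmap] from here on. *)
Lemma tens_ext m n (V : lmodType R) (F G : 'M[R]_(m * n) -> V) :
    linear F -> linear G -> (forall A B, F (A *t B) = G (A *t B)) -> F =1 G.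
Proof.
move=> /linear_packed[{}F ->] /linear_packed[{}G ->] FG rho.
rewrite [rho]matrix_sum_delta !linear_sum; apply: eq_bigr => i _.
rewrite !linear_sum; apply: eq_bigr => j _; rewrite !linearZ; congr (_ *: _).
case: (mxtens_indexP i) => i1 i2; case: (mxtens_indexP j) => j1 j2.
by rewrite -delta_tens; apply: FG.
Qed.

End Tensor.

(** * Kraus operators *)

Section Maps.
Variable R : realType.
Local Notation C := R[i].

Definition sandwich m n (K L : 'M[C]_(n, m)) (rho : 'M[C]_m) : 'M[C]_n :=
  K *m rho *m L^t*.

Lemma sandwich_linear m n (K L : 'M[C]_(n, m)) : linear (sandwich K L).
Proof.
by move=> c x y; rewrite /sandwich mulmxDr mulmxDl -scalemxAr -scalemxAl.
Qed.

Lemma tensmap_linear m n p q (F : 'M[C]_m -> 'M[C]_p) (G : 'M[C]_n -> 'M[C]_q) :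
  linear (tensmap F G).
Proof.
move=> c x y; rewrite /tensmap scaler_sumr -big_split; apply: eq_bigr => i _.
rewrite /= scaler_sumr -big_split; apply: eq_bigr => j _ /=.
by rewrite !mxE scalerDl scalerA.
Qed.

Lemma tensmapE m n p q (F : 'M[C]_m -> 'M[C]_p) (G : 'M[C]_n -> 'M[C]_q) A B :
  linear F -> linear G -> tensmap F G (A *t B) = F A *t G B.
Proof.
move=> /linear_packed[{}F ->] /linear_packed[{}G ->].
rewrite {2}[A]matrix_sum_delta.
rewrite {2}[B]matrix_sum_delta !linear_sum tensmx_suml /tensmap.
rewrite (reindex (@mxtens_index m n)); last first.
  by exists (@mxtens_unindex m n) => i _; rewrite (mxtens_indexK, mxtens_unindexK).
under [RHS]eq_bigr do rewrite tensmx_sumr.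
rewrite [RHS]pair_big; apply: eq_bigr => -[i1 i2] _.
rewrite (reindex (@mxtens_index m n)); last first.
  by exists (@mxtens_unindex m n) => i _; rewrite (mxtens_indexK, mxtens_unindexK).
rewrite mxtens_indexK [(i1, i2).1]/= [(i1, i2).2]/= !linear_sum tensmx_suml.
under [RHS]eq_bigr do rewrite tensmx_sumr.
rewrite [RHS]pair_big; apply: eq_bigr => -[j1 j2] _.
by rewrite mxtens_indexK tensmxE !linearZ /= tensmxZl tensmxZr scalerA.
Qed.

Lemma eq_tensmap m n p q (F F' : 'M[C]_m -> 'M[C]_p) (G G' : 'M[C]_n -> 'M[C]_q) :
  F =1 F' -> G =1 G' -> tensmap F G =1 tensmap F' G'.
Proof.
move=> FF' GG' rho; apply: eq_bigr => i _; apply: eq_bigr => j _.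
by rewrite FF' GG'.
Qed.

Lemma tensmap_sandwich m n p q (K K' : 'M[C]_(p, m)) (L L' : 'M[C]_(q, n)) :
  tensmap (sandwich K K') (sandwich L L') =1 sandwich (K *t L) (K' *t L').
Proof.
apply: tens_ext => [||A B]; [exact: tensmap_linear|exact: sandwich_linear|].
rewrite tensmapE; try exact: sandwich_linear.
by rewrite /sandwich adjmx_tens !tensmx_mul.
Qed.

Lemma linear_id m : linear (@id 'M[C]_m).
Proof. by []. Qed.

Lemma tensmap_comp m n p q r s (F : 'M[C]_p -> 'M[C]_r) (G : 'M[C]_q -> 'M[C]_s)
    (F' : 'M[C]_m -> 'M[C]_p) (G' : 'M[C]_n -> 'M[C]_q) :
  linear F -> linear G -> linear F' -> linear G' ->
  tensmap F G \o tensmap F' G' =1 tensmap (F \o F') (G \o G').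
Proof.
move=> lF lG lF' lG'; apply: tens_ext => [||A B].
- by apply: linear_comp; apply: tensmap_linear.
- exact: tensmap_linear.
- by rewrite /= !tensmapE //; apply: linear_comp.
Qed.

Lemma tensmapDr m n p q (F : 'M[C]_m -> 'M[C]_p) (G G' : 'M[C]_n -> 'M[C]_q) rho :
  tensmap F (G \+ G') rho = tensmap F G rho + tensmap F G' rho.
Proof.
rewrite -big_split; apply: eq_bigr => i _; rewrite -big_split /=.
by apply: eq_bigr => j _; rewrite tensmxDr scalerDr.
Qed.

Lemma sandwich1 m : sandwich 1%:M 1%:M =1 @id 'M[C]_m.
Proof. by move=> rho; rewrite /sandwich mul1mx adjmx1 mulmx1. Qed.

Lemma is_cp_sandwich m n (K : 'M[C]_(n, m)) : is_cp (sandwich K K).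
Proof.
split=> [|k rho psd v]; first exact: sandwich_linear.
rewrite (eq_tensmap (F' := sandwich 1%:M 1%:M) (fun x => esym (sandwich1 x))
  (fun=> erefl)) tensmap_sandwich /sandwich.
by have := psd (v *m (1%:M *t K)); rewrite adjmxM !mulmxA.
Qed.

Lemma eq_is_cp m n (F G : 'M[C]_m -> 'M[C]_n) : F =1 G -> is_cp F -> is_cp G.
Proof.
move=> FG [linF cpF]; split=> [c x y|k rho psd]; first by rewrite -!FG linF.
by rewrite -(eq_tensmap (fun=> erefl) FG); apply: cpF.
Qed.

Lemma is_cpD m n (F G : 'M[C]_m -> 'M[C]_n) :
  is_cp F -> is_cp G -> is_cp (F \+ G).
Proof.
move=> [lF cF] [lG cG]; split=> [c x y|k rho psd v].
  by rewrite /= lF lG scalerDr addrACA.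
rewrite tensmapDr mulmxDr mulmxDl mxE.
by apply: addr_ge0; [apply: cF|apply: cG].
Qed.

(** Polarization over the complex numbers: the form at [v + z *: w] for z = 1 and z = 'i separates
    the two mixed terms. It makes positive matrices hermitian, which [psdmx] does not demand
    explicitly. *)
Lemma quadratic_form_eq0 n (N : 'M[C]_n) :
  (forall v : 'rV[C]_n, (v *m N *m v^t*) 0 0 = 0) -> N = 0.
Proof.
move=> N0; have addE (A B : 'M[C]_1) : (A + B) 0 0 = A 0 0 + B 0 0 by rewrite mxE.
have sclE c (A : 'M[C]_1) : (c *: A) 0 0 = c * A 0 0 by rewrite mxE.
have {}N0 (v w : 'rV[C]_n) : (v *m N *m w^t*) 0 0 = 0.
  have P (z : C) :
      z^*%R * (v *m N *m w^t*) 0 0 + z * (w *m N *m v^t*) 0 0 = 0.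
    have := N0 (v + z *: w); rewrite adjmxD adjmxZ !(mulmxDl, mulmxDr).
    rewrite -!scalemxAl -!scalemxAr !(addE, sclE) !N0 !mulr0.
    by rewrite addr0 add0r addrC.
  have := P 1; rewrite rmorph1 !mul1r => /eqP; rewrite addr_eq0 => /eqP e.
  have := P 'i%C; rewrite e.
  have -> : ('i%C : C)^*%R = - 'i%C by simpc.
  rewrite mulrN mulNr opprK -mulr2n => /eqP; rewrite mulrn_eq0 /= mulf_eq0.
  by case/orP=> [|/eqP ->]; rewrite ?oppr0 // eq_complex /= oner_eq0 andbF.
apply/matrixP => i j; have := N0 (delta_mx 0 i) (delta_mx 0 j).
have -> : ((delta_mx 0 j)^t* : 'cV[C]_n) = delta_mx j 0.
  by rewrite trmx_delta map_delta_mx.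
by rewrite -rowE -colE !mxE.
Qed.

Lemma psdmx_hermitian n (M : 'M[C]_n) : psdmx M -> M^t* = M.
Proof.
move=> psd; apply/esym/eqP; rewrite -subr_eq0; apply/eqP.
apply: quadratic_form_eq0 => v; rewrite mulmxBr mulmxBl mxE [X in _ + X]mxE.
have -> : v *m M^t* *m v^t* = (v *m M *m v^t*)^t*.
  by rewrite !adjmxM adjmxK mulmxA.
by rewrite adjmxE (CrealP (ger0_real (psd v))) subrr.
Qed.

(** Spectral theorem: the vectors are the rows of the diagonalizing unitary, scaled by the square
    roots of the eigenvalues. *)
Lemma psdmx_gram n (M : 'M[C]_n) :
  psdmx M -> exists v : 'I_n -> 'rV[C]_n, M = \sum_l (v l)^t* *m v l.
Proof.
move=> psd; have nM : M \is normalmx.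
  by apply/normalmxP; rewrite psdmx_hermitian.
have /orthomx_spectralP := nM; set P := spectralmx M => eM.
have uP : P \is unitarymx := spectral_unitarymx M.
set d := spectral_diag M in eM.
have d_ge0 l : 0 <= d 0 l.
  have := psd (row l P); rewrite eM invmx_unitary //.
  rewrite rowE adjmxM !mulmxA -[_ *m P *m P^t*]mulmxA.
  rewrite (unitarymxP _) // mulmx1 -[_ *m P *m P^t*]mulmxA (unitarymxP _) //.
  rewrite mulmx1 trmx_delta map_delta_mx -!mulmxA mul_diag_mx.
  rewrite -rowE !mxE !eqxx mulr1.
  by [].
exists (fun l => sqrtC (d 0 l) *: row l P).
rewrite eM invmx_unitary //; apply/matrixP => i j.
rewrite summxE -mulmxA mxE; apply: eq_bigr => l _.
rewrite adjmxZ -scalemxAr -scalemxAl scalerA mxE mul_diag_mx !mxE.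
rewrite big_ord1 !mxE.
have -> : sqrtC (d 0 l) * (sqrtC (d 0 l))^*%R = d 0 l.
  by rewrite geC0_conj ?sqrtC_ge0 // -expr2 sqrtCK.
by rewrite mulrCA.
Qed.

(* The Choi matrix of a completely positive map is positive, hence a sum of
   rank-one projections; reshaping their vectors gives Kraus operators. *)
Lemma is_cp_kraus m n (F : 'M[C]_m -> 'M[C]_n) :
  is_cp F -> exists s : seq 'M[C]_(n, m),
    F =1 fun rho => \sum_(K <- s) sandwich K K rho.
Proof.
move=> [linF cpF].
(* The unnormalized maximally entangled vector: [w^t* *m w] is the sum of all E_kl (x) E_kl, so
   [tensmap id F] sends it to the Choi matrix of [F]. *)
pose w : 'rV[C]_(m * m) :=
  \row_i ((mxtens_unindex i).1 == (mxtens_unindex i).2)%:R.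
have psdw : psdmx (w^t* *m w).
  move=> v; rewrite mulmxA -mulmxA.
  have -> : w *m v^t* = (v *m w^t*)^t* by rewrite adjmxM adjmxK.
  by rewrite mxE big_ord1 !mxE mul_conjC_ge0.
have [v eJ] := psdmx_gram (cpF _ _ psdw).
(* The conjugate appears because the Choi matrix is a sum of [(v l)^t* *m v l] with row vectors
   [v l]. *)
exists [seq (\matrix_(a, i) ((v l) 0 (mxtens_index (i, a)))^*%R) | l <- index_enum _].
have FE i j a b : F (delta_mx i j) a b =
    \sum_l (v l 0 (mxtens_index (i, a)))^*%R * v l 0 (mxtens_index (j, b)).
  have /matrixP/(_ (mxtens_index (i, a)) (mxtens_index (j, b))) := eJ.
  rewrite [X in _ = X -> _]summxE; under [X in _ = X -> _]eq_bigr do rewrite !mxE big_ord1 !mxE.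
  move=> <-.
  have -> : w^t* *m w = \sum_k \sum_l (delta_mx k l *t delta_mx k l).
    apply/matrixP => x y; rewrite summxE mxE big_ord1 !mxE.
    rewrite (bigD1 (mxtens_unindex x).1) //= summxE.
    rewrite (bigD1 (mxtens_unindex y).1) //= [X in _ = X + _ + _]mxE !mxE.
    rewrite [X in _ + X + _]big1 => [|l /negPf nl]; last first.
      by rewrite !mxE [_ == l]eq_sym nl andbF mul0r.
    rewrite [X in _ + X]big1 => [|k /negPf nk]; last first.
      by rewrite summxE big1 // => l _; rewrite !mxE [_ == k]eq_sym nk mul0r.
    rewrite !eqxx mul1r !addr0 rmorph_nat -natrM mulnb.
    by congr (_ && _)%:R; rewrite eq_sym.
  have tE k l : tensmap id F (delta_mx k l *t delta_mx k l) =
      delta_mx k l *t F (delta_mx k l) by exact: tensmapE.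
  have [T eT] := linear_packed (tensmap_linear (@id 'M[C]_m) F).
  rewrite eT in tE *; rewrite linear_sum summxE (bigD1 i) //= linear_sum summxE (bigD1 j) //=.
  rewrite tE tensmxE mxE !eqxx mul1r.
  rewrite [X in _ + X + _]big1 => [|l /negPf nl]; last first.
    by rewrite tE tensmxE mxE [j == l]eq_sym nl andbF mul0r.
  rewrite [X in _ + X]big1 ?addr0 // => k /negPf nk.
  rewrite linear_sum summxE big1 // => l _.
  by rewrite tE tensmxE mxE [i == k]eq_sym nk mul0r.
have [F' eF] := linear_packed linF; rewrite eF in FE *.
move=> rho; rewrite big_map; apply/matrixP => a b.
rewrite {1}[rho]matrix_sum_delta linear_sum !summxE.
under eq_bigr do rewrite linear_sum summxE.
under eq_bigr do under eq_bigr do rewrite linearZ mxE FE mulr_sumr.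
under eq_bigr do rewrite exchange_big.
rewrite exchange_big; apply: eq_bigr => l _ /=.
rewrite !mxE exchange_big; apply: eq_bigr => j _ /=.
rewrite !mxE mulr_suml; apply: eq_bigr => i _; rewrite !mxE conjCK.
by rewrite mulrA [_^*%R * rho i j]mulrC.
Qed.

End Maps.

(** * Separable maps *)

Section Separable.
Variable R : realType.
Local Notation C := R[i].

Definition sepmap m n p q (F : 'M[C]_(m * n) -> 'M[C]_(p * q)) : Prop :=
  exists s : seq ('M[C]_(p, m) * 'M[C]_(q, n)),
    F =1 fun rho => \sum_(k <- s) sandwich (k.1 *t k.2) (k.1 *t k.2) rho.

Lemma eq_sepmap m n p q (F G : 'M[C]_(m * n) -> 'M[C]_(p * q)) :
  F =1 G -> sepmap F -> sepmap G.
Proof. by move=> FG [s Fs]; exists s => rho; rewrite -FG. Qed.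

Lemma sepmap_linear m n p q (F : 'M[C]_(m * n) -> 'M[C]_(p * q)) :
  sepmap F -> linear F.
Proof.
move=> [s Fs] c x y; rewrite !Fs scaler_sumr -big_split.
by apply: eq_bigr => k _; rewrite sandwich_linear.
Qed.

Lemma sepmap0 m n p q : sepmap (fun=> 0 : 'M[C]_(p * q)) (m := m) (n := n).
Proof. by exists [::] => rho; rewrite big_nil. Qed.

Lemma sepmapD m n p q (F G : 'M[C]_(m * n) -> 'M[C]_(p * q)) :
  sepmap F -> sepmap G -> sepmap (F \+ G).
Proof.
by move=> [s Fs] [t Gt]; exists (s ++ t) => rho; rewrite big_cat /= Fs Gt.
Qed.

Lemma sepmap_sum m n p q (I : Type) (r : seq I) (P : pred I)
    (F : I -> 'M[C]_(m * n) -> 'M[C]_(p * q)) :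
  (forall i, sepmap (F i)) -> sepmap (fun rho => \sum_(i <- r | P i) F i rho).
Proof.
move=> sF; elim: r => [|i r IHr].
  by apply: eq_sepmap (@sepmap0 m n p q) => rho; rewrite big_nil.
case Pi: (P i); last by apply: eq_sepmap IHr => rho; rewrite big_cons Pi.
by apply: eq_sepmap (sepmapD (sF i) IHr) => rho; rewrite big_cons Pi.
Qed.

Lemma sepmap_sandwich m n p q (A : 'M[C]_(p, m)) (B : 'M[C]_(q, n)) :
  sepmap (sandwich (A *t B) (A *t B)).
Proof. by exists [:: (A, B)] => rho; rewrite big_seq1. Qed.

Lemma sandwich_comp m n p (K K' : 'M[C]_(p, n)) (L L' : 'M[C]_(n, m)) rho :
  sandwich K K' (sandwich L L' rho) = sandwich (K *m L) (K' *m L') rho.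
Proof. by rewrite /sandwich adjmxM !mulmxA. Qed.

Lemma sepmap_comp m n p q r s (F : 'M[C]_(p * q) -> 'M[C]_(r * s))
    (G : 'M[C]_(m * n) -> 'M[C]_(p * q)) :
  sepmap F -> sepmap G -> sepmap (F \o G).
Proof.
move=> [t Ft] [u Gu]; apply: eq_sepmap (_ : sepmap (fun rho =>
  \sum_(k <- t) \sum_(l <- u)
     sandwich ((k.1 *m l.1) *t (k.2 *m l.2)) ((k.1 *m l.1) *t (k.2 *m l.2)) rho)).
  move=> rho; rewrite /= Ft; apply: eq_bigr => k _.
  have [f ef] := linear_packed (sandwich_linear (k.1 *t k.2) (k.1 *t k.2)).
  rewrite Gu ef linear_sum -ef; apply: eq_bigr => l _.
  by rewrite sandwich_comp tensmx_mul.
by apply: sepmap_sum => k; apply: sepmap_sum => l; apply: sepmap_sandwich.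
Qed.

Lemma sepmap_tensmap m n p q (F : 'M[C]_m -> 'M[C]_p) (G : 'M[C]_n -> 'M[C]_q) :
  is_cp F -> is_cp G -> sepmap (tensmap F G).
Proof.
move=> cpF cpG; have [[lF _] [lG _]] := (cpF, cpG).
have [s Fs] := is_cp_kraus cpF; have [t Gt] := is_cp_kraus cpG.
apply: eq_sepmap (_ : sepmap (fun rho =>
  \sum_(K <- s) \sum_(L <- t) sandwich (K *t L) (K *t L) rho)).
  apply: tens_ext => [||A B].
  - by do 2![apply: linear_sumf => ?]; apply: sandwich_linear.
  - exact: tensmap_linear.
  - rewrite tensmapE // Fs Gt tensmx_suml; apply: eq_bigr => K _.
    rewrite tensmx_sumr; apply: eq_bigr => L _.
    by rewrite /sandwich adjmx_tens !tensmx_mul.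
by apply: sepmap_sum => K; apply: sepmap_sum => L; apply: sepmap_sandwich.
Qed.

Lemma is_tp_tensmap m n p q (I : finType) (E : I -> 'M[C]_m -> 'M[C]_p)
    (T : I -> 'M[C]_n -> 'M[C]_q) :
    (forall i, linear (E i)) -> (forall i, linear (T i)) ->
    is_tp (fun rho => \sum_i E i rho) -> (forall i, is_tp (T i)) ->
  is_tp (fun rho => \sum_i tensmap (E i) (T i) rho).
Proof.
move=> lE lT tpE tpT.
apply: (@tens_ext _ _ _ C^o) => [||A B].
- apply: (linear_comp (@mxtrace_linear _ _)).
  by apply: linear_sumf => i; apply: tensmap_linear.
- exact: mxtrace_linear.
- rewrite mxtrace_tens -tpE !raddf_sum mulr_suml; apply: eq_bigr => i _ /=.
  by rewrite tensmapE // mxtrace_tens tpT.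
Qed.

Lemma is_tp_tensmap_r m n p q (I : finType) (T : I -> 'M[C]_m -> 'M[C]_p)
    (E : I -> 'M[C]_n -> 'M[C]_q) :
    (forall i, linear (T i)) -> (forall i, linear (E i)) ->
    (forall i, is_tp (T i)) -> is_tp (fun rho => \sum_i E i rho) ->
  is_tp (fun rho => \sum_i tensmap (T i) (E i) rho).
Proof.
move=> lT lE tpT tpE.
apply: (@tens_ext _ _ _ C^o) => [||A B].
- apply: (linear_comp (@mxtrace_linear _ _)).
  by apply: linear_sumf => i; apply: tensmap_linear.
- exact: mxtrace_linear.
- rewrite mxtrace_tens -tpE !raddf_sum mulr_sumr; apply: eq_bigr => i _ /=.
  by rewrite tensmapE // mxtrace_tens tpT.
Qed.

Lemma one_way_sepmap m n p q (I : finType)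
    (G : I -> 'M[C]_(m * n) -> 'M[C]_(p * q)) :
  one_way G ->
  (forall i, sepmap (G i)) /\ is_tp (fun rho => \sum_i G i rho).
Proof.
have ext (F F' : I -> 'M[C]_(m * n) -> 'M[C]_(p * q)) :
    (forall i, F i =1 F' i) ->
    (forall i, sepmap (F' i)) /\ is_tp (fun rho => \sum_i F' i rho) ->
    (forall i, sepmap (F i)) /\ is_tp (fun rho => \sum_i F i rho).
  move=> FF' [sF' tpF']; split=> [i|rho].
    by apply: eq_sepmap (sF' i) => rho; rewrite FF'.
  by rewrite -[RHS]tpF'; congr mxtrace; apply: eq_bigr => i _; rewrite FF'.
case=> [[E [T [[cpE tpE] cT GE]]]|[T [E [[cpE tpE] cT GE]]]].
- apply: (ext G (fun i => tensmap (E i) (T i)) GE); split=> [i|].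
    by apply: sepmap_tensmap; case: (cT i).
  by apply: is_tp_tensmap => // i; [case: (cpE i)|case: (cT i) => -[]|case: (cT i)].
- apply: (ext G (fun i => tensmap (T i) (E i)) GE); split=> [i|].
    by apply: sepmap_tensmap; case: (cT i).
  by apply: is_tp_tensmap_r => // i; [case: (cT i) => -[]|case: (cpE i)|case: (cT i)].
Qed.

Lemma locc_rounds_sepmap m n p q (I : finType)
    (E : I -> 'M[C]_(m * n) -> 'M[C]_(p * q)) :
  locc_rounds E ->
  (forall i, sepmap (E i)) /\ is_tp (fun rho => \sum_i E i rho).
Proof.
elim=> [|{}p {}q {}I {}E r s J G _ [sE tpE] owG].
  split=> [_|rho]; last first.
    by rewrite (big_pred1 tt) // => -[].
  apply: eq_sepmap (sepmap_sandwich 1%:M 1%:M) => rho.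
  by rewrite tensmx11 sandwich1.
have sG i := one_way_sepmap (owG i); split=> [k|rho].
  by apply: sepmap_comp => //; apply: (sG (tag k)).1.
rewrite -(sig_big_dep xpredT (fun=> xpredT) (fun i j => G i j (E i rho))) /=.
rewrite raddf_sum -[RHS]tpE raddf_sum; apply: eq_bigr => i _ /=.
exact: (sG i).2.
Qed.

(** Trace preservation is asked of the sum of the two parts: this is how the signs of an LOCC map
    are normalized, it is stable under composition, and it fixes tr P(1) + tr M(1) in the overlap
    bound. *)
Definition sep_diff m n p q (F : 'M[C]_(m * n) -> 'M[C]_(p * q)) : Prop :=
  exists P M : 'M[C]_(m * n) -> 'M[C]_(p * q),
    [/\ sepmap P, sepmap M, is_tp (P \+ M) & F =1 P \- M].

Lemma eq_sep_diff m n p q (F G : 'M[C]_(m * n) -> 'M[C]_(p * q)) :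
  F =1 G -> sep_diff F -> sep_diff G.
Proof.
by move=> FG [P [M [sP sM tp eF]]]; exists P, M; split=> // rho; rewrite -FG.
Qed.

Lemma LOCC_sep_diff m n (F : 'M[C]_(m * n) -> 'M[C]_(m * n)) :
  LOCC F -> sep_diff F.
Proof.
move=> [K] [E] [s] [[I] [E0] [f] [/locc_rounds_sepmap[sE0 tpE0] eE] eF].
have sE k : sepmap (E k).
  by apply: eq_sepmap (sepmap_sum _ _ sE0) => rho; rewrite eE.
exists (fun rho => \sum_(k | ~~ s k) E k rho), (fun rho => \sum_(k | s k) E k rho).
split; [exact: sepmap_sum|exact: sepmap_sum|move=> rho|move=> rho].
- rewrite -[RHS]tpE0 /= addrC; have := bigID s xpredT (fun k => E k rho).
  move=> /= <-; congr mxtrace.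
  under eq_bigr do rewrite eE.
  by rewrite [RHS](partition_big f xpredT).
- rewrite eF (bigID s) /= addrC -sumrN; congr (_ + _); apply: eq_bigr => k.
    by move=> /negPf ->; rewrite scale1r.
  by move=> ->; rewrite expr1 scaleN1r.
Qed.

Lemma sep_diff_tp m n p q (F : 'M[C]_(m * n) -> 'M[C]_(p * q)) :
  sepmap F -> is_tp F -> sep_diff F.
Proof.
move=> sF tpF; exists F, (fun=> 0); split=> // [|rho|rho].
- exact: sepmap0.
- by rewrite /= addr0.
- by rewrite /= subr0.
Qed.

Lemma sep_diff_comp m n p q r s (F : 'M[C]_(p * q) -> 'M[C]_(r * s))
    (G : 'M[C]_(m * n) -> 'M[C]_(p * q)) :
  sep_diff F -> sep_diff G -> sep_diff (F \o G).
Proof.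
move=> [P [M [sP sM tpF eF]]] [P' [M' [sP' sM' tpG eG]]].
(* Signs multiply: equal signs form the positive part, opposite signs the negative part. The two
   parts add up to the composition of P + M with P' + M', which preserves the trace. *)
exists ((P \o P') \+ (M \o M')), ((P \o M') \+ (M \o P')).
have [[f ef] [g eg]] :=
  (linear_packed (sepmap_linear sP), linear_packed (sepmap_linear sM)).
split; try by apply: sepmapD; apply: sepmap_comp.
- by move=> rho; rewrite -[RHS]tpG -[RHS]tpF /= ef eg !linearD /=; ring.
- move=> rho; rewrite /= eF /= eG /= ef eg !linearB /=.
  by rewrite opprK [- _ + g _]addrC addrACA -opprD.
Qed.

Lemma sep_diff_id m n : sep_diff (@id 'M[C]_(m * n)).
Proof.
apply: sep_diff_tp => //; apply: eq_sepmap (sepmap_sandwich 1%:M 1%:M) => rho.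
by rewrite tensmx11 sandwich1.
Qed.

Lemma sep_diff_compose m n N (f : 'I_N -> 'M[C]_(m * n) -> 'M[C]_(m * n)) :
  (forall j, sep_diff (f j)) -> sep_diff (compose f).
Proof.
move=> sf; rewrite /compose; apply: big_ind => //; first exact: sep_diff_id.
by move=> g h; apply: sep_diff_comp.
Qed.

End Separable.

(** * The overlap witness *)

Section Witness.
Variable R : realType.
Local Notation C := R[i].

(** The quadratic form of the Choi matrix of [F] at the vectorization of [Th]. It is linear in [F]
    and does not refer to a choice of Kraus operators. *)
Definition overlap d (Th : 'M[C]_d) (F : 'M[C]_d -> 'M[C]_d) : C :=
  \sum_i \sum_j \sum_i' \sum_j'
     (Th i j)^*%R * Th i' j' * F (delta_mx j j') i i'.

Definition hsdot m n (A B : 'M[C]_(m, n)) : C := \tr (A^t* *m B).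

Lemma hsdotE m n (A B : 'M[C]_(m, n)) :
  hsdot A B = \sum_i \sum_j (A i j)^*%R * B i j.
Proof.
rewrite exchange_big; apply: eq_bigr => j _; rewrite mxE.
by apply: eq_bigr => i _; rewrite adjmxE.
Qed.

Lemma overlap_sandwich d (Th K L : 'M[C]_d) :
  overlap Th (sandwich K L) = hsdot Th K * (hsdot Th L)^*%R.
Proof.
rewrite !hsdotE rmorph_sum mulr_suml; apply: eq_bigr => i _.
rewrite mulr_suml; apply: eq_bigr => j _.
rewrite mulr_sumr; apply: eq_bigr => i' _.
rewrite rmorph_sum mulr_sumr; apply: eq_bigr => j' _.
have -> : sandwich K L (delta_mx j j') i i' = K i j * (L i' j')^*%R.
  rewrite /sandwich mxE (bigD1 j') //= big1 => [|k /negPf nk].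
    rewrite addr0 adjmxE mxE (bigD1 j) //= big1 => [|k /negPf nk].
      by rewrite addr0 !mxE !eqxx mulr1.
    by rewrite mxE nk mulr0.
  by rewrite mxE big1 ?mul0r // => l _; rewrite mxE nk andbF mulr0.
by rewrite rmorphM /= conjCK mulrACA.
Qed.

Lemma eq_overlap d (Th : 'M[C]_d) F G : F =1 G -> overlap Th F = overlap Th G.
Proof. by move=> FG; do 4![apply: eq_bigr => ? _]; rewrite FG. Qed.

Lemma overlap_sum d (Th : 'M[C]_d) (I : Type) (r : seq I) (P : pred I)
    (F : I -> 'M[C]_d -> 'M[C]_d) :
  overlap Th (fun rho => \sum_(k <- r | P k) F k rho) =
  \sum_(k <- r | P k) overlap Th (F k).
Proof.
rewrite /overlap; do 4![rewrite [RHS]exchange_big; apply: eq_bigr => ? _].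
by rewrite summxE mulr_sumr.
Qed.

Lemma overlapZ d (Th : 'M[C]_d) c (F : 'M[C]_d -> 'M[C]_d) :
  overlap Th (fun rho => c *: F rho) = c * overlap Th F.
Proof.
rewrite /overlap; do 4![rewrite mulr_sumr; apply: eq_bigr => ? _].
by rewrite mxE mulrCA.
Qed.

Lemma overlapB d (Th : 'M[C]_d) (F G : 'M[C]_d -> 'M[C]_d) :
  overlap Th (F \- G) = overlap Th F - overlap Th G.
Proof.
rewrite /overlap; do 4![rewrite -sumrB; apply: eq_bigr => ? _].
by rewrite !mxE mulrBr.
Qed.

Lemma hsdot_ge0 m n (A : 'M[C]_(m, n)) : 0 <= hsdot A A.
Proof.
rewrite hsdotE; apply: sumr_ge0 => i _; apply: sumr_ge0 => j _.
by rewrite mulrC mul_conjC_ge0.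
Qed.

Lemma hsdotDl m n (A A' B : 'M[C]_(m, n)) :
  hsdot (A + A') B = hsdot A B + hsdot A' B.
Proof. by rewrite /hsdot adjmxD mulmxDl mxtraceD. Qed.

Lemma hsdotDr m n (A B B' : 'M[C]_(m, n)) :
  hsdot A (B + B') = hsdot A B + hsdot A B'.
Proof. by rewrite /hsdot mulmxDr mxtraceD. Qed.

Lemma hsdotZl m n c (A B : 'M[C]_(m, n)) : hsdot (c *: A) B = c^*%R * hsdot A B.
Proof. by rewrite /hsdot adjmxZ -scalemxAl mxtraceZ. Qed.

Lemma hsdotZr m n c (A B : 'M[C]_(m, n)) : hsdot A (c *: B) = c * hsdot A B.
Proof. by rewrite /hsdot -scalemxAr mxtraceZ. Qed.

Lemma hsdot_suml m n (I : Type) (r : seq I) (P : pred I)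
    (A : I -> 'M[C]_(m, n)) B :
  hsdot (\sum_(i <- r | P i) A i) B = \sum_(i <- r | P i) hsdot (A i) B.
Proof. by rewrite /hsdot adjmx_sum mulmx_suml raddf_sum. Qed.

Lemma hsdot_sumr m n (I : Type) (r : seq I) (P : pred I)
    (B : I -> 'M[C]_(m, n)) A :
  hsdot A (\sum_(i <- r | P i) B i) = \sum_(i <- r | P i) hsdot A (B i).
Proof. by rewrite /hsdot mulmx_sumr raddf_sum. Qed.

Lemma hsdotC m n (A B : 'M[C]_(m, n)) : hsdot B A = (hsdot A B)^*%R.
Proof.
rewrite !hsdotE rmorph_sum; apply: eq_bigr => i _.
rewrite rmorph_sum; apply: eq_bigr => j _.
by rewrite rmorphM /= conjCK mulrC.
Qed.

Lemma hsdot_tens m n p q (A A' : 'M[C]_(m, n)) (B B' : 'M[C]_(p, q)) :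
  hsdot (A *t B) (A' *t B') = hsdot A A' * hsdot B B'.
Proof. by rewrite /hsdot adjmx_tens tensmx_mul mxtrace_tens. Qed.

Lemma sqr_normC_subE (x y : C) :
  `|x - y| ^+ 2 = `|x| ^+ 2 + `|y| ^+ 2 - (x * y^*%R + (x * y^*%R)^*%R).
Proof.
by rewrite !normCK rmorphB rmorphM /= conjCK; ring.
Qed.

(** Lagrange's identity: the sum over k, l of the squared moduli of [x k * (y l)^* - x l * (y k)^*]
    is twice the difference of the two sides. *)
Lemma cauchy_schwarz_sum (I : finType) (x y : I -> C) :
  `|\sum_k x k * y k| ^+ 2 <= (\sum_k `|x k| ^+ 2) * (\sum_k `|y k| ^+ 2).
Proof.
set z := \sum_k _; set X := \sum_k _; set Y := \sum_k _.
have : 0 <= \sum_k \sum_l `|x k * (y l)^*%R - x l * (y k)^*%R| ^+ 2.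
  by do 2!apply: sumr_ge0 => ? _; rewrite exprn_ge0.
have -> : \sum_k \sum_l `|x k * (y l)^*%R - x l * (y k)^*%R| ^+ 2 =
    (X * Y - `|z| ^+ 2) *+ 2.
  under eq_bigr => k _ do under eq_bigr => l _ do
    rewrite sqr_normC_subE !normrM !norm_conjC !exprMn.
  have zz : `|z| ^+ 2 =
      \sum_k \sum_l x k * (y l)^*%R * (x l * (y k)^*%R)^*%R.
    rewrite normCK rmorph_sum mulr_suml; apply: eq_bigr => k _.
    rewrite mulr_sumr; apply: eq_bigr => l _.
    by rewrite !rmorphM /= conjCK; ring.
  have XY : X * Y = \sum_k \sum_l `|x k| ^+ 2 * `|y l| ^+ 2.
    by rewrite mulr_suml; apply: eq_bigr => k _; rewrite mulr_sumr.
  have YX : X * Y = \sum_k \sum_l `|x l| ^+ 2 * `|y k| ^+ 2.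
    by rewrite XY exchange_big.
  have zz' : `|z| ^+ 2 =
      \sum_k \sum_l (x k * (y l)^*%R * (x l * (y k)^*%R)^*%R)^*%R.
    rewrite -[LHS]geC0_conj ?exprn_ge0 // zz rmorph_sum.
    by apply: eq_bigr => k _; rewrite rmorph_sum.
  rewrite mulrnBl !mulr2n {1}XY YX {1}zz zz' opprD -!sumrN -!big_split.
  apply: eq_bigr => k _; rewrite -!sumrN -!big_split.
  by apply: eq_bigr => l _; rewrite opprD.
by rewrite pmulrn_lge0 // subr_ge0.
Qed.

(** The [S k] have squared norm d, so [d K - c] is d times the component of [K] orthogonal to them;
    the inequality says that its squared norm is nonnegative. *)
Lemma bessel (I : finType) d (S : I -> 'M[C]_d) (K : 'M[C]_d) :
    (0 < d)%N -> (forall k l, hsdot (S k) (S l) = d%:R * (k == l)%:R) ->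
  \sum_k `|hsdot (S k) K| ^+ 2 <= d%:R * hsdot K K.
Proof.
move=> d_gt0 orthoS; have d0 : 0 < d%:R :> C by rewrite ltr0n.
pose c := \sum_k hsdot (S k) K *: S k.
have cK : hsdot c K = \sum_k `|hsdot (S k) K| ^+ 2.
  by rewrite hsdot_suml; apply: eq_bigr => k _; rewrite hsdotZl normCKC.
have cc : hsdot c c = d%:R * \sum_k `|hsdot (S k) K| ^+ 2.
  rewrite hsdot_suml mulr_sumr; apply: eq_bigr => k _.
  rewrite hsdotZl hsdot_sumr (bigD1 k) //= big1 => [|l /negPf nl].
    by rewrite addr0 hsdotZr orthoS eqxx mulr1 normCK; ring.
  by rewrite hsdotZr orthoS eq_sym nl !mulr0.
have Kc : hsdot K c = \sum_k `|hsdot (S k) K| ^+ 2.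
  by rewrite hsdotC cK geC0_conj // sumr_ge0 // => k _; rewrite exprn_ge0.
have := hsdot_ge0 (d%:R *: K + (-1) *: c).
rewrite !(hsdotDl, hsdotDr, hsdotZl, hsdotZr) cK Kc cc !rmorphN !rmorph1.
rewrite conjC_nat -(pmulr_rge0 _ d0); set X := \sum_k _; set Y := hsdot K K.
move=> pos; have {pos} : 0 <= d%:R * d%:R * (d%:R * Y - X).
  by apply: le_trans pos _; rewrite le_eqVlt; apply/orP; left; apply/eqP; ring.
by rewrite pmulr_rge0 ?mulr_gt0 // subr_ge0.
Qed.

(** Separability enters here: for a Kraus operator K (x) L the inner product with the witness is a
    sum of products of an A-coefficient and a B-coefficient. Cauchy-Schwarz splits it, and Bessel
    bounds each side by its own norm. *)
Lemma overlap_sepmap (I : finType) m n (S : I -> 'M[C]_m) (T : I -> 'M[C]_n)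
    (P : 'M[C]_(m * n) -> 'M[C]_(m * n)) :
    (0 < m)%N -> (0 < n)%N ->
    (forall k l, hsdot (S k) (S l) = m%:R * (k == l)%:R) ->
    (forall k l, hsdot (T k) (T l) = n%:R * (k == l)%:R) ->
    sepmap P ->
  0 <= overlap (\sum_k S k *t T k) P <= (m * n)%:R * \tr (P 1%:M).
Proof.
move=> m0 n0 oS oT [s eP]; rewrite (eq_overlap _ eP) eP raddf_sum.
rewrite (overlap_sum _ s xpredT) mulr_sumr.
have bound (k : 'M[C]_m * 'M[C]_n) :
    0 <= overlap (\sum_k S k *t T k) (sandwich (k.1 *t k.2) (k.1 *t k.2)) <=
    (m * n)%:R * \tr (sandwich (k.1 *t k.2) (k.1 *t k.2) 1%:M).
  case: k => K L /=; rewrite overlap_sandwich mul_conjC_ge0 -normCK /=.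
  rewrite /sandwich mulmx1 mxtrace_mulC -[\tr _]/(hsdot _ _) hsdot_tens.
  rewrite hsdot_suml; under eq_bigr do rewrite hsdot_tens.
  apply: le_trans (cauchy_schwarz_sum _ _) _.
  rewrite natrM mulrACA ler_pM ?bessel // sumr_ge0 // => k _; exact: exprn_ge0.
apply/andP; split; first by apply: sumr_ge0 => k _; case/andP: (bound k).
by apply: ler_sum => k _; case/andP: (bound k).
Qed.

(* For separable P and M with P + M trace preserving, p = tr P(1) and
   q = tr M(1) satisfy p + q = m * n, and the overlap of a (P - M) is at most
   m * n * |a| times p or q, according to the sign of a. *)
Lemma overlap_sep_diff (I : finType) m n (S : I -> 'M[C]_m) (T : I -> 'M[C]_n)
    (a : R) (F : 'M[C]_(m * n) -> 'M[C]_(m * n)) :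
    (0 < m)%N -> (0 < n)%N ->
    (forall k l, hsdot (S k) (S l) = m%:R * (k == l)%:R) ->
    (forall k l, hsdot (T k) (T l) = n%:R * (k == l)%:R) ->
    sep_diff F ->
  2 * (a%:C * overlap (\sum_k S k *t T k) F) <=
  (m * n)%:R * (`|a|%:C * (m * n)%:R + a%:C * \tr (F 1%:M)).
Proof.
move=> m0 n0 oS oT [P [M [sP sM tpPM eF]]].
have /andP[P_ge0 P_le] := overlap_sepmap m0 n0 oS oT sP.
have /andP[M_ge0 M_le] := overlap_sepmap m0 n0 oS oT sM.
rewrite (eq_overlap _ eF) overlapB eF /= raddfB /=.
have := tpPM 1%:M; rewrite mxtrace1 /= mxtraceD => {2}<-.
move: P_ge0 P_le M_ge0 M_le; set D := (m * n)%:R; set p := \tr _; set q := \tr _.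
set x := overlap _ P; set y := overlap _ M => P_ge0 P_le M_ge0 M_le.
have [a_ge0|/ltW a_le0] := ger0P a.
  have -> : D * (a%:C * (p + q) + a%:C * (p - q)) = 2 * (a%:C * (D * p)) by ring.
  rewrite ler_pM2l ?ltr0n // ler_wpM2l ?ler0c //.
  by apply: le_trans P_le; rewrite gerBl.
have -> : D * ((- a)%:C * (p + q) + a%:C * (p - q)) = 2 * ((- a)%:C * (D * q)).
  by rewrite rmorphN /=; ring.
rewrite ler_pM2l ?ltr0n // -[a%:C * _]opprK -mulrN -mulNr -rmorphN opprB.
rewrite ler_wpM2l ?ler0c ?oppr_ge0 //.
by apply: le_trans M_le; rewrite gerBl.
Qed.

Lemma sep_diff_sum_lower_bound (I : finType) m n (S : I -> 'M[C]_m)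
    (T : I -> 'M[C]_n) (L : finType) (a : L -> R)
    (F : L -> 'M[C]_(m * n) -> 'M[C]_(m * n)) (r : I -> R) (U : 'M[C]_(m * n)) :
    (0 < m)%N -> (0 < n)%N ->
    (forall k l, hsdot (S k) (S l) = m%:R * (k == l)%:R) ->
    (forall k l, hsdot (T k) (T l) = n%:R * (k == l)%:R) ->
    (forall k, 0 <= r k) -> \sum_k r k ^+ 2 = 1 ->
    U = \sum_k (r k)%:C *: (S k *t T k) ->
    (forall l, sep_diff (F l)) ->
    sandwich U U =1 (fun rho => \sum_l (a l)%:C *: F l rho) ->
  2 * (\sum_k r k) ^+ 2 <= 1 + \sum_l `|a l|.
Proof.
move=> m0 n0 oS oT r_ge0 r_sum1 eU sF eF; pose Th := \sum_k S k *t T k.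
have D_gt0 : 0 < (m * n)%:R :> C by rewrite ltr0n muln_gt0 m0.
have := ler_sum (index_enum L)
  (fun l (_ : true) => overlap_sep_diff (a l) m0 n0 oS oT (sF l)).
rewrite -!mulr_sumr big_split /= -mulr_suml.
(* The terms together form the channel of [U], and the squared norm of [U] is m n by orthogonality
   and the normalization of [r]. *)
have -> : \sum_l (a l)%:C * \tr (F l 1%:M) = (m * n)%:R.
  under eq_bigr do rewrite -mxtraceZ.
  rewrite -raddf_sum -eF /sandwich mulmx1 /= mxtrace_mulC -[LHS]/(hsdot U U).
  have rc k : (r k)%:C^*%R = (r k)%:C :> C by rewrite geC0_conj // ler0c.
  have r_sum1C : \sum_k (r k)%:C ^+ 2 = 1 :> C.
    rewrite -[RHS](rmorph1 (real_complex R)) -r_sum1 rmorph_sum.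
    by apply: eq_bigr => k _; rewrite rmorphXn.
  rewrite {1}eU hsdot_suml -[RHS]mulr1 -[X in _ = _ * X]r_sum1C mulr_sumr.
  apply: eq_bigr => k _; rewrite eU hsdotZl hsdot_sumr (bigD1 k) //= big1 => [|l /negPf nl].
    by rewrite addr0 hsdotZr hsdot_tens oS oT eqxx rc natrM /=; ring.
  by rewrite hsdotZr hsdot_tens oS eq_sym nl mulr0 mul0r mulr0.
under eq_bigr do rewrite -overlapZ.
rewrite -overlap_sum -(eq_overlap _ eF) overlap_sandwich.
(* The witness has the directions of [U] with all coefficients equal to 1, so its inner product with
   [U] sees the plain sum of the [r k]. *)
have -> : hsdot Th U = (m * n)%:R * (\sum_k r k)%:C.
  rewrite eU hsdot_suml rmorph_sum mulr_sumr; apply: eq_bigr => k _.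
  rewrite hsdot_sumr (bigD1 k) //= big1 => [|l /negPf nl].
    by rewrite addr0 hsdotZr hsdot_tens oS oT eqxx !mulr1 natrM mulrC.
  by rewrite hsdotZr hsdot_tens oS eq_sym nl mulr0 mul0r mulr0.
have Dc : (m * n)%:R^*%R = (m * n)%:R :> C by rewrite conjC_nat.
set D : C := (m * n)%:R in Dc D_gt0 *; set t := \sum_k r k.
have tc : (t%:C)^*%R = t%:C :> C.
  by apply/geC0_conj; rewrite ler0c sumr_ge0.
rewrite -rmorph_sum; set kappa := \sum_i _ => le.
have : (2 * t ^+ 2)%:C <= (1 + kappa)%:C; last by rewrite lecR.
rewrite -(ler_pM2l D_gt0) -(ler_pM2l D_gt0).
have -> : D * (D * (1 + kappa)%:C) = D * (kappa%:C * D + D).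
  by rewrite rmorphD rmorph1 /=; ring.
apply: le_trans le; rewrite [(D * t%:C)^*%R]rmorphM /= Dc tc.
by rewrite rmorphM rmorph_nat rmorphXn /= le_eqVlt; apply/orP; left; apply/eqP; ring.
Qed.

End Witness.

(** * Local operations are LOCC *)

Section LocalInLOCC.
Variable R : realType.
Local Notation C := R[i].

Lemma is_cptp_id m : is_cptp (@id 'M[C]_m).
Proof.
by split; [apply: eq_is_cp (@sandwich1 R m) (is_cp_sandwich _)|].
Qed.

Lemma one_way_A m n p (I : finType) (E : I -> 'M[C]_m -> 'M[C]_p) :
  is_instrument E -> one_way (fun i => tensmap (E i) (@id 'M[C]_n)).
Proof.
by move=> insE; left; exists E, (fun=> id); split=> // i; apply: is_cptp_id.
Qed.

Lemma one_way_B m n q (I : finType) (E : I -> 'M[C]_n -> 'M[C]_q) :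
  is_instrument E -> one_way (fun i => tensmap (@id 'M[C]_m) (E i)).
Proof.
by move=> insE; right; exists (fun=> id), E; split=> // i; apply: is_cptp_id.
Qed.

Lemma bool_instrument m (Ap Am : 'M[C]_m -> 'M[C]_m) :
  is_cp Ap -> is_cp Am -> is_cptp (Ap \+ Am) ->
  is_instrument (fun b : bool => if b then Am else Ap).
Proof.
move=> cp cm [_ tp]; split=> [[]//|rho].
by rewrite big_bool /= addrC; apply: tp.
Qed.

(** Each side measures which of its two completely positive parts occurs, in two successive rounds;
    the sign of the pair is the parity of the two outcomes. Hence an LO decomposition bounds the
    LOCC value from above, and the LOCC lower bound applies to LO. *)
Lemma LO_LOCC m n (F : 'M[C]_(m * n) -> 'M[C]_(m * n)) : LO F -> LOCC F.
Proof.
move=> [FA [FB [[Ap [Am [cAp cAm tA eA]]] [Bp [Bm [cBp cBm tB eB]]] eF]]].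
have insA := bool_instrument cAp cAm tA; have insB := bool_instrument cBp cBm tB.
set EA := fun b : bool => _ in insA; set EB := fun b : bool => _ in insB.
have rounds := locc_round (locc_round (locc_start R m n)
  (fun=> one_way_A n insA)) (fun=> one_way_B m insB).
exists {i : {i : unit & bool} & bool}; eexists.
exists (fun k => tagged (tag k) (+) tagged k); split.
  exists {i : {i : unit & bool} & bool}; eexists; exists id.
  by split; [exact: rounds|move=> k rho; rewrite big_pred1_eq].
move=> rho.
rewrite -(sig_big_dep xpredT (fun=> xpredT) (fun (i : {i : unit & bool}) (j : bool) =>
  (-1) ^+ (tagged i (+) j) *:
    tensmap id (EB j) (tensmap (EA (tagged i)) id rho))) /=.
rewrite -(sig_big_dep xpredT (fun=> xpredT) (fun (u : unit) (i : bool) => \sum_(j : bool)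
  (-1) ^+ (i (+) j) *: tensmap id (EB j) (tensmap (EA i) id rho))) /=.
have sum_unit (V : nmodType) (f : unit -> V) : \sum_u f u = f tt.
  by rewrite (big_pred1 tt) // => -[].
rewrite sum_unit !big_bool /=.
have [lAp lAm lBp lBm] : [/\ linear Ap, linear Am, linear Bp & linear Bm].
  by split; [case: cAp|case: cAm|case: cBp|case: cBm].
have comp A B : linear A -> linear B ->
    tensmap (@id 'M[C]_m) B (tensmap A (@id 'M[C]_n) rho) = tensmap A B rho.
  by move=> lA lB; apply: (tensmap_comp (@linear_id R m) lB lA (@linear_id R n)).
rewrite !comp // ?expr1 ?expr0 eF (eq_tensmap eA eB) !scaleN1r !scale1r.
have tensB (A A' : 'M[C]_m -> 'M[C]_m) (B : 'M[C]_n -> 'M[C]_n) :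
    tensmap (A \- A') B rho = tensmap A B rho - tensmap A' B rho.
  rewrite -sumrB; apply: eq_bigr => i _; rewrite -sumrB; apply: eq_bigr => j _.
  by rewrite -scalerBr; congr (_ *: _); apply/matrixP => x y; rewrite !mxE mulrBl.
have tensB' (A : 'M[C]_m -> 'M[C]_m) (B B' : 'M[C]_n -> 'M[C]_n) :
    tensmap A (B \- B') rho = tensmap A B rho - tensmap A B' rho.
  rewrite -sumrB; apply: eq_bigr => i _; rewrite -sumrB; apply: eq_bigr => j _.
  by rewrite -scalerBr; congr (_ *: _); apply/matrixP => x y; rewrite !mxE mulrBr.
by rewrite tensB !tensB' opprB addrC [- _ + _]addrC.
Qed.

End LocalInLOCC.

(** * Ancillas *)

Section Ancilla.

Lemma swap_midE m n p q a b c d :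
  @swap_mid m n p q (mxtens_index (mxtens_index (a, b), mxtens_index (c, d))) =
  mxtens_index (mxtens_index (a, c), mxtens_index (b, d)).
Proof. by rewrite /swap_mid !mxtens_indexK. Qed.

Lemma swap_midK m n p q : cancel (@swap_mid m n p q) (@swap_mid m p n q).
Proof.
move=> i; case: (mxtens_indexP i) => i1 i2; case: (mxtens_indexP i1) => a b.
by case: (mxtens_indexP i2) => c d; rewrite !swap_midE.
Qed.

Lemma reorderK (T : Type) m n p q : cancel (@reorder T m n p q) (@reorder T m p n q).
Proof. by move=> M; apply/matrixP => i j; rewrite !mxE !swap_midK. Qed.

Variable R : realType.
Local Notation C := R[i].

Lemma reorder_linear m n p q : linear (@reorder C m n p q).
Proof. by move=> c x y; apply/matrixP => i j; rewrite !mxE. Qed.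

Lemma reorder_mul m n p q (M N : 'M[C]_((m * n) * (p * q))) :
  reorder (M *m N) = reorder M *m reorder N.
Proof.
apply/matrixP => i j; rewrite !mxE (reindex (@swap_mid m p n q)) /=.
  by apply: eq_bigr => k _; rewrite !mxE.
by exists (@swap_mid m n p q) => k _; rewrite swap_midK.
Qed.

Lemma reorder_adj m n p q (M : 'M[C]_((m * n) * (p * q))) :
  reorder (M^t*) = (reorder M)^t*.
Proof. by apply/matrixP => i j; rewrite !mxE. Qed.

Lemma reorder_tens m n p q (a : 'M[C]_m) (b : 'M[C]_n) (c : 'M[C]_p) (d : 'M[C]_q) :
  reorder ((a *t b) *t (c *t d)) = (a *t c) *t (b *t d).
Proof.
apply/matrixP => i j; rewrite mxE.
case: (mxtens_indexP i) => i1 i2; case: (mxtens_indexP i1) => i3 i4.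
case: (mxtens_indexP i2) => i5 i6; case: (mxtens_indexP j) => j1 j2.
case: (mxtens_indexP j1) => j3 j4; case: (mxtens_indexP j2) => j5 j6.
by rewrite !swap_midE !tensmxE mulrACA.
Qed.

Lemma reorder_sandwich m n p q (K L rho : 'M[C]_((m * n) * (p * q))) :
  reorder (sandwich K L rho) = sandwich (reorder K) (reorder L) (reorder rho).
Proof. by rewrite /sandwich !reorder_mul reorder_adj. Qed.

Lemma tens4_ext m n p q (V : lmodType C) (F G : 'M[C]_((m * n) * (p * q)) -> V) :
    linear F -> linear G ->
    (forall a b c d, F ((a *t b) *t (c *t d)) = G ((a *t b) *t (c *t d))) ->
  F =1 G.
Proof.
move=> lF lG FG; apply: tens_ext => // A B.
have linl (H : 'M[C]_((m * n) * (p * q)) -> V) Y :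
    linear H -> linear (fun X => H (X *t Y)).
  by move=> lH c x y; rewrite tensmxDl tensmxZl lH.
have linr (H : 'M[C]_((m * n) * (p * q)) -> V) X :
    linear H -> linear (fun Y => H (X *t Y)).
  by move=> lH c x y; rewrite tensmxDr tensmxZr lH.
apply: (tens_ext (linl F B lF) (linl G B lG)) => a b.
by apply: (tens_ext (linr F (a *t b) lF) (linr G (a *t b) lG)) => c d.
Qed.

Lemma on_AB_sandwich dA dB eA eB (P : 'M[C]_dA) (Q : 'M[C]_dB) :
  @on_AB R dA dB eA eB (sandwich (P *t Q) (P *t Q)) =1
  sandwich ((P *t 1%:M) *t (Q *t 1%:M)) ((P *t 1%:M) *t (Q *t 1%:M)).
Proof.
move=> rho; rewrite /on_AB.
rewrite (eq_tensmap (F' := sandwich (P *t Q) (P *t Q))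
  (G' := sandwich 1%:M 1%:M)) => [||x]; rewrite ?sandwich1 //.
by rewrite tensmap_sandwich reorder_sandwich reorderK -tensmx11 !reorder_tens.
Qed.

Lemma ptrace2_tens m n (A : 'M[C]_m) (B : 'M[C]_n) :
  ptrace2 (A *t B) = \tr B *: A.
Proof.
apply/matrixP => i j; rewrite !mxE mulr_suml; apply: eq_bigr => k _.
by rewrite tensmxE mulrC.
Qed.

Lemma ptrace2_linear m n : linear (@ptrace2 R m n).
Proof.
move=> c x y; apply/matrixP => i j; rewrite !mxE mulr_sumr -big_split.
by apply: eq_bigr => k _; rewrite !mxE.
Qed.

Lemma trace_anc_linear dA dB eA eB : linear (@trace_anc R dA dB eA eB).
Proof. exact: linear_comp (@ptrace2_linear _ _) (@reorder_linear _ _ _ _). Qed.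

Lemma trace_anc_tens dA dB eA eB (a : 'M[C]_dA) (e : 'M[C]_eA) (b : 'M[C]_dB)
    (f : 'M[C]_eB) :
  trace_anc ((a *t e) *t (b *t f)) = (\tr e * \tr f) *: (a *t b).
Proof. by rewrite /trace_anc reorder_tens ptrace2_tens mxtrace_tens. Qed.

Lemma trace_anc_tp dA dB eA eB : is_tp (@trace_anc R dA dB eA eB).
Proof.
apply: (@tens4_ext _ _ _ _ C^o) => [||a e b f].
- exact: linear_comp (@mxtrace_linear _ _) (@trace_anc_linear _ _ _ _).
- exact: mxtrace_linear.
- by rewrite trace_anc_tens mxtraceZ !mxtrace_tens; ring.
Qed.

(** The operator 1 (x) <x|. Over all x these are the Kraus operators of the partial trace; the
    adjoint appends the ancilla state |x>. *)
Definition slot_mx d e (x : 'I_e) : 'M[C]_(d, d * e) :=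
  \matrix_(i, j) (j == mxtens_index (i, x))%:R.

Lemma slot_mx_tens d e (x : 'I_e) (a : 'M[C]_d) (b : 'M[C]_e) :
  sandwich (slot_mx d x) (slot_mx d x) (a *t b) = b x x *: a.
Proof.
apply/matrixP => i j; rewrite /sandwich mxE (bigD1 (mxtens_index (j, x))) //=.
rewrite big1 => [|k /negPf nk]; last by rewrite adjmxE !mxE nk conjC0 mulr0.
rewrite addr0 adjmxE mxE (bigD1 (mxtens_index (i, x))) //=.
rewrite big1 => [|k /negPf nk]; last by rewrite mxE nk mul0r.
by rewrite addr0 tensmxE !mxE !eqxx conjC1 mul1r mulr1 mulrC.
Qed.

Lemma slot_mx_adj_tens d e (x : 'I_e) (a : 'M[C]_d) :
  sandwich ((slot_mx d x)^t*) ((slot_mx d x)^t*) a = a *t delta_mx x x.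
Proof.
rewrite /sandwich adjmxK; apply/matrixP => i j.
case: (mxtens_indexP i) => i1 i2; case: (mxtens_indexP j) => j1 j2.
rewrite tensmxE mxE (bigD1 j1) //= big1 => [|k /negPf nk]; last first.
  rewrite [slot_mx _ _ _ _]mxE (can_eq (@mxtens_indexK _ _)) xpair_eqE.
  by rewrite [j1 == k]eq_sym nk mulr0.
rewrite addr0 mxE (bigD1 i1) //= big1 => [|k /negPf nk]; last first.
  rewrite adjmxE [slot_mx _ _ _ _]mxE (can_eq (@mxtens_indexK _ _)) xpair_eqE.
  by rewrite [i1 == k]eq_sym nk conjC0 mul0r.
rewrite addr0 adjmxE !mxE !(can_eq (@mxtens_indexK _ _)) !xpair_eqE !eqxx /=.
by rewrite conjC_nat -mulnb natrM; ring.
Qed.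

Lemma trace_anc_sepmap dA dB eA eB : sepmap (@trace_anc R dA dB eA eB).
Proof.
apply: eq_sepmap (_ : sepmap (fun rho => \sum_(x < eA) \sum_(y < eB)
  sandwich (slot_mx dA x *t slot_mx dB y) (slot_mx dA x *t slot_mx dB y) rho)).
  apply: tens4_ext => [||a e b f].
  - by do 2![apply: linear_sumf => ?]; apply: sandwich_linear.
  - exact: trace_anc_linear.
  - rewrite trace_anc_tens mulr_suml scaler_suml; apply: eq_bigr => x _.
    rewrite mulr_sumr scaler_suml; apply: eq_bigr => y _.
    rewrite -tensmap_sandwich tensmapE; try exact: sandwich_linear.
    by rewrite !slot_mx_tens tensmxZl tensmxZr scalerA.
by do 2![apply: sepmap_sum => ?]; apply: sepmap_sandwich.
Qed.

Lemma init_anc_linear dA dB eA eB : linear (@init_anc R dA dB eA eB).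
Proof.
by move=> c x y; rewrite /init_anc tensmxDl tensmxZl reorder_linear.
Qed.

Lemma init_anc_tp dA dB eA eB : is_tp (@init_anc R dA dB eA eB).
Proof.
apply: (@tens_ext _ _ _ C^o) => [||a b].
- exact: linear_comp (@mxtrace_linear _ _) (@init_anc_linear _ _ _ _).
- exact: mxtrace_linear.
- have tr_delta d : \tr (delta_mx ord0 ord0 : 'M[C]_d.+1) = 1.
    rewrite /mxtrace (bigD1 ord0) //= big1 => [|i /negPf ni]; first by rewrite mxE addr0.
    by rewrite mxE ni.
  by rewrite /init_anc reorder_tens !mxtrace_tens !tr_delta !mulr1.
Qed.

Lemma init_anc_sepmap dA dB eA eB : sepmap (@init_anc R dA dB eA eB).
Proof.
pose k d e : 'M[C]_(d * e.+1, d) := (slot_mx d (ord0 : 'I_e.+1))^t*.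
apply: eq_sepmap (sepmap_sandwich (k dA eA) (k dB eB)).
apply: tens_ext => [||a b]; [exact: sandwich_linear|exact: init_anc_linear|].
rewrite -tensmap_sandwich tensmapE; try exact: sandwich_linear.
by rewrite !slot_mx_adj_tens /init_anc reorder_tens.
Qed.

End Ancilla.

(** * Lower bound for LOCC decompositions *)

Section LowerBound.
Variable R : realType.
Local Notation C := R[i].

Lemma eq_compose (T : Type) N (f g : 'I_N -> T -> T) :
  (forall j, f j =1 g j) -> compose f =1 compose g.
Proof.
move=> fg; rewrite /compose; apply: (big_ind2 (fun F G : T -> T => F =1 G)) => //.
by move=> F F' G G' FF' GG' x /=; rewrite GG' FF'.
Qed.

Lemma compose_sandwich d N (K : 'I_N -> 'M[C]_d) :
  compose (fun j => sandwich (K j) (K j)) =1 sandwich (\prod_j K j) (\prod_j K j).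
Proof.
rewrite /compose.
apply: (big_ind2 (fun (F : 'M[C]_d -> 'M[C]_d) L => F =1 sandwich L L)) => //.
  by move=> x; rewrite sandwich1.
by move=> F K1 G K2 eF eG x; rewrite /= eG eF sandwich_comp.
Qed.

Lemma prod_scale_tens m n (I : Type) (s : seq I) (c : I -> C) (A : I -> 'M[C]_m)
    (B : I -> 'M[C]_n) :
  \prod_(i <- s) (c i *: (A i *t B i)) =
  (\prod_(i <- s) c i) *: ((\prod_(i <- s) A i) *t (\prod_(i <- s) B i)).
Proof.
elim: s => [|i s IHs]; first by rewrite !big_nil scale1r tensmx11.
by rewrite !big_cons IHs -!mulmxE -scalemxAl -scalemxAr scalerA tensmx_mul.
Qed.

Lemma sandwich_tp m n (K : 'M[C]_(n, m)) : K^t* *m K = 1%:M -> is_tp (sandwich K K).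
Proof. by move=> KK rho; rewrite mxtrace_mulC mulmxA KK mul1mx. Qed.

Lemma unitarymx_tens m n (A : 'M[C]_m) (B : 'M[C]_n) :
  A \is unitarymx -> B \is unitarymx -> A *t B \is unitarymx.
Proof.
move=> uA uB; apply/unitarymxP.
by rewrite adjmx_tens tensmx_mul !(unitarymxP _) // tensmx11.
Qed.

Lemma unitarymx1 n : (1%:M : 'M[C]_n) \is unitarymx.
Proof. by apply/unitarymxP; rewrite adjmx1 mulmx1. Qed.

Lemma is_cptp_unitary n (U : 'M[C]_n) : U \is unitarymx -> is_cptp (sandwich U U).
Proof.
move=> uU; split; first exact: is_cp_sandwich.
by apply: sandwich_tp; apply: unitarymx_adjmxM.
Qed.

Lemma LOCC_decomposition_lower_bound dA dB N (J : finType)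
    (r : 'I_N -> J -> R) (S : 'I_N -> J -> 'M[C]_dA) (T : 'I_N -> J -> 'M[C]_dB)
    (P : 'I_N -> 'M[C]_dA) (Q : 'I_N -> 'M[C]_dB)
    (E : 'I_N -> 'M[C]_(dA * dB) -> 'M[C]_(dA * dB))
    eA eB l (a : 'I_l -> R) F :
    (0 < dA)%N -> (0 < dB)%N ->
    (forall j k, 0 <= r j k) ->
    \sum_(k : {ffun 'I_N -> J}) (\prod_j r j (k j)) ^+ 2 = 1 ->
    (forall j, P j \is unitarymx) -> (forall j, Q j \is unitarymx) ->
    (forall k k' : {ffun 'I_N -> J},
      hsdot (\prod_j (P j *m S j (k j))) (\prod_j (P j *m S j (k' j))) =
      dA%:R * (k == k')%:R) ->
    (forall k k' : {ffun 'I_N -> J},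
      hsdot (\prod_j (Q j *m T j (k j))) (\prod_j (Q j *m T j (k' j))) =
      dB%:R * (k == k')%:R) ->
    (forall j, E j = conj_channel (\sum_k (r j k)%:C *: (S j k *t T j k))) ->
    bb_decomposition (@LOCC R) E (eA := eA) (eB := eB) a F ->
  2 * (\sum_(k : {ffun 'I_N -> J}) \prod_j r j (k j)) ^+ 2 <= 1 + \sum_i `|a i|.
Proof.
move=> dA0 dB0 r0 r1 uP uQ oP oQ eE [_ LF bb].
pose X j := sandwich (P j *t Q j) (P j *t Q j).
have cX j : is_cptp (X j) by apply: is_cptp_unitary; apply: unitarymx_tens.
(* A whole term of the decomposition as a map on AB: preparing and discarding the ancillas are
   themselves separable and trace preserving, so the ancillas disappear from the estimate. *)
pose G i := @trace_anc R dA dB eA.+1 eB.+1 \o compose (fun j => on_AB (X j) \o F i j) \o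
  @init_anc R dA dB eA eB.
apply: (sep_diff_sum_lower_bound (F := G) dA0 dB0 oP oQ _ r1 erefl).
- by move=> k; apply: prodr_ge0 => j _.
- move=> i; apply: sep_diff_comp; last first.
    by apply: sep_diff_tp; [apply: init_anc_sepmap|apply: init_anc_tp].
  apply: sep_diff_comp.
    by apply: sep_diff_tp; [apply: trace_anc_sepmap|apply: trace_anc_tp].
  apply: sep_diff_compose => j; apply: sep_diff_comp.
    apply: eq_sep_diff (fsym (@on_AB_sandwich _ _ _ _ _ _ _)) _.
    apply: sep_diff_tp; first exact: sepmap_sandwich.
    apply: sandwich_tp; apply: unitarymx_adjmxM.
    by do 2?apply: unitarymx_tens; rewrite ?unitarymx1.
  exact: LOCC_sep_diff.
move=> rho; transitivity (compose (fun j => X j \o E j) rho).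
  rewrite (eq_compose (g := fun j => sandwich ((P j *t Q j) *m \sum_k (r j k)%:C *: (S j k *t T j k))
     ((P j *t Q j) *m \sum_k (r j k)%:C *: (S j k *t T j k)))); last first.
    by move=> j x; rewrite -sandwich_comp eE.
  rewrite compose_sandwich.
  have -> : \prod_j ((P j *t Q j) *m \sum_k (r j k)%:C *: (S j k *t T j k)) =
      \sum_(k : {ffun 'I_N -> J}) (\prod_j r j (k j))%:C *:
        (\prod_j (P j *m S j (k j)) *t \prod_j (Q j *m T j (k j))).
    (* Expanding the product of sums chooses one index per gate, hence one string per function from
       gates to [J]. *)
    under eq_bigr do rewrite mulmx_sumr.
    rewrite bigA_distr_bigA; apply: eq_bigr => k _.
    under eq_bigr do rewrite -scalemxAr tensmx_mul.
    by rewrite prod_scale_tens rmorph_prod.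
  by [].
rewrite bb //.
have [t et] := linear_packed (@trace_anc_linear R dA dB eA.+1 eB.+1).
rewrite /G et linear_sum; apply: eq_bigr => i _.
by rewrite linearZ.
Qed.

End LowerBound.

(** * Operators on qubits *)

Section Qubits.
Variable R : realType.
Local Notation C := R[i].

Definition pure_tens n (f : 'I_n -> 'M[C]_2) : 'M[C]_(qdim n) :=
  \matrix_(x, y) \prod_i f i (bits x i) (bits y i).

Lemma pure_tensE n (f : 'I_n -> 'M[C]_2) x y :
  pure_tens f x y = \prod_i f i (bits x i) (bits y i).
Proof. by rewrite mxE. Qed.

Lemma eq_pure_tens n (f g : 'I_n -> 'M[C]_2) :
  (forall i, f i = g i) -> pure_tens f = pure_tens g.
Proof.
by move=> fg; apply/matrixP => x y; rewrite !mxE; apply: eq_bigr => i _; rewrite fg.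
Qed.

Lemma bits_inj n : injective (@bits n).
Proof. exact: enum_val_inj. Qed.

Lemma reindex_bits n (V : nmodType) (F : {ffun 'I_n -> 'I_2} -> V) :
  \sum_(x : 'I_(qdim n)) F (bits x) = \sum_x F x.
Proof.
rewrite [RHS](reindex (@bits n)) //; exists (@enum_rank _) => x _.
  exact: enum_valK.
exact: enum_rankK.
Qed.

Lemma pure_tensM n (f g : 'I_n -> 'M[C]_2) :
  pure_tens f *m pure_tens g = pure_tens (fun i => f i *m g i).
Proof.
apply/matrixP => x y; rewrite mxE pure_tensE.
under [RHS]eq_bigr do rewrite mxE.
rewrite bigA_distr_bigA -reindex_bits; apply: eq_bigr => z _.
by rewrite !pure_tensE -big_split.
Qed.

Lemma pure_tens_adj n (f : 'I_n -> 'M[C]_2) :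
  (pure_tens f)^t* = pure_tens (fun i => (f i)^t*).
Proof.
apply/matrixP => x y; rewrite adjmxE !pure_tensE rmorph_prod.
by apply: eq_bigr => i _; rewrite adjmxE.
Qed.

Lemma pure_tens1 n : pure_tens (fun _ : 'I_n => 1%:M) = 1%:M.
Proof.
apply/matrixP => x y; rewrite pure_tensE mxE; have [->|nxy] := eqVneq x y.
  by rewrite big1 // => i _; rewrite mxE eqxx.
have [i nxyi] : exists i, bits x i != bits y i.
  apply/existsP; apply: contraR nxy; rewrite negb_exists => /forallP eq_xy.
  by apply/eqP/bits_inj/ffunP => i; apply/eqP; move: (eq_xy i); rewrite negbK.
by rewrite (bigD1 i) //= mxE (negPf nxyi) mul0r.
Qed.

Lemma pure_tens_tr n (f : 'I_n -> 'M[C]_2) : \tr (pure_tens f) = \prod_i \tr (f i).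
Proof.
rewrite bigA_distr_bigA -reindex_bits.
by apply: eq_bigr => x _; rewrite pure_tensE.
Qed.

Lemma pure_tens_hsdot n (f g : 'I_n -> 'M[C]_2) :
  hsdot (pure_tens f) (pure_tens g) = \prod_i hsdot (f i) (g i).
Proof. by rewrite /hsdot pure_tens_adj pure_tensM pure_tens_tr. Qed.

Definition at_qubit n (a : 'I_n) (V : 'M[C]_2) : 'M[C]_(qdim n) :=
  pure_tens (fun i => if i == a then V else 1%:M).

Lemma at_qubitE n (a : 'I_n) V x y :
  at_qubit a V x y =
  if [forall k, (k != a) ==> (bits x k == bits y k)]
  then V (bits x a) (bits y a) else 0.
Proof.
rewrite pure_tensE; case: ifPn => [/forallP eq_xy|].
  rewrite (bigD1 a) //= eqxx big1 ?mulr1 // => k nka.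
  by rewrite (negPf nka) mxE; move: (eq_xy k); rewrite nka /= => ->.
rewrite negb_forall => /existsP[k]; rewrite negb_imply => /andP[nka nxy].
by rewrite (bigD1 k) //= (negPf nka) mxE (negPf nxy) mul0r.
Qed.

Lemma at_qubitM n (a : 'I_n) V W :
  at_qubit a V *m at_qubit a W = at_qubit a (V *m W).
Proof.
by rewrite pure_tensM; apply: eq_pure_tens => i; case: ifP; rewrite ?mulmx1.
Qed.

Lemma at_qubit_adj n (a : 'I_n) V : (at_qubit a V)^t* = at_qubit a (V^t*).
Proof.
by rewrite pure_tens_adj; apply: eq_pure_tens => i; case: ifP; rewrite ?adjmx1.
Qed.

Lemma at_qubit_unitary n (a : 'I_n) V :
  V \is unitarymx -> at_qubit a V \is unitarymx.
Proof.
move=> uV; apply/unitarymxP; rewrite at_qubit_adj at_qubitM (unitarymxP _) //.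
by rewrite -pure_tens1; apply: eq_pure_tens => i; case: ifP.
Qed.

Lemma gate_on_tens nA nB (a : 'I_nA) (b : 'I_nB) (V W : 'M[C]_2) :
  gate_on a b (V *t W) = at_qubit a V *t at_qubit b W.
Proof.
apply/matrixP => x y; case: (mxtens_indexP x) => x1 x2.
case: (mxtens_indexP y) => y1 y2; rewrite tensmxE !at_qubitE mxE !mxtens_indexK.
cbv zeta; rewrite tensmxE /=.
set p := [forall k, (k != a) ==> _]; set q := [forall k, (k != b) ==> _].
by case: p; case: q; rewrite /= ?mul0r ?mulr0.
Qed.

Lemma gate_on_sum nA nB (a : 'I_nA) (b : 'I_nB) (I : finType) (c : I -> C)
    (M : I -> 'M[C]_(2 * 2)) :
  gate_on a b (\sum_k c k *: M k) = \sum_k c k *: gate_on a b (M k).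
Proof.
apply/matrixP => x y; rewrite mxE summxE.
under [RHS]eq_bigr do rewrite !mxE.
cbv zeta; case: ifP => _; last by rewrite big1 // => k _; rewrite mulr0.
by rewrite summxE; apply: eq_bigr => k _; rewrite !mxE.
Qed.

Lemma permute_at_qubit n (a b : 'I_n) : exists2 Q : 'M[C]_(qdim n),
  Q \is unitarymx & forall V, Q *m at_qubit b V *m Q^t* = at_qubit a V.
Proof.
pose p (x : 'I_(qdim n)) : 'I_(qdim n) :=
  enum_rank [ffun i => bits x (tperm a b i)].
have bp x i : bits (p x) i = bits x (tperm a b i).
  by rewrite /bits enum_rankK ffunE.
have p_inj : injective p.
  move=> x y eq_p; apply/bits_inj/ffunP => i.
  by rewrite -(tpermK a b i) -!bp eq_p.
have adjQ : (perm_mx (perm p_inj))^t* = perm_mx (perm p_inj)^-1%g :> 'M[C]_(qdim n).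
  by rewrite tr_perm_mx map_perm_mx.
exists (perm_mx (perm p_inj)).
  by apply/unitarymxP; rewrite adjQ -perm_mxM mulgV perm_mx1.
move=> V; rewrite adjQ -row_permE -col_permE; apply/matrixP => x y.
rewrite [LHS]mxE [LHS]mxE !permE !pure_tensE (reindex_inj (@perm_inj _ (tperm a b))).
apply: eq_bigr => i _; rewrite !bp !tpermK.
by rewrite -(inj_eq (@perm_inj _ (tperm a b))) tpermK tpermR.
Qed.

Lemma pauli_unitary k : pauli R k \is unitarymx.
Proof.
apply/unitarymxP/matrixP => i j; rewrite mxE !big_ord_recl big_ord0 !adjmxE.
by case: k => [[|[|[|[|//]]]] ?]; case: i => [[|[|//]] ?];
  case: j => [[|[|//]] ?]; rewrite /pauli /= !mxE /=; simpc; rewrite ?expr0 ?expr1;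
  simpc.
Qed.

Lemma pauli_orthogonal k l : k != l -> hsdot (pauli R k) (pauli R l) = 0.
Proof.
move=> nkl; rewrite hsdotE !big_ord_recl !big_ord0.
move: nkl; case: k => [[|[|[|[|//]]]] ?]; case: l => [[|[|[|[|//]]]] ?] //= _;
  by rewrite /pauli /= !mxE /=; simpc; rewrite ?expr0 ?expr1; simpc; rewrite ?addNr ?subrr.
Qed.

Lemma pure_tens_prod n N (f : 'I_N -> 'I_n -> 'M[C]_2) :
  \prod_j pure_tens (f j) = pure_tens (fun i => \prod_j f j i).
Proof.
elim: (index_enum _) => [|j s IHs].
  by rewrite big_nil -[LHS]pure_tens1; apply: eq_pure_tens => i; rewrite big_nil.
rewrite big_cons IHs -mulmxE pure_tensM; apply: eq_pure_tens => i.
by rewrite big_cons.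
Qed.

(** As the slots are distinct, qubit [s j] carries the single factor [M j], and one vanishing factor
    kills the whole product of inner products. *)
Lemma string_orthogonal n N (s : 'I_N -> 'I_n) (M M' : 'I_N -> 'M[C]_2) j :
    injective s -> hsdot (M j) (M' j) = 0 ->
  hsdot (\prod_j at_qubit (s j) (M j)) (\prod_j at_qubit (s j) (M' j)) = 0.
Proof.
move=> s_inj MM'; rewrite !pure_tens_prod pure_tens_hsdot.
have atE (L : 'I_N -> 'M[C]_2) :
    \prod_j' (if s j == s j' then L j' else 1%:M) = L j.
  rewrite -big_mkcond (big_pred1 j) // => j'.
  by rewrite (inj_eq s_inj) eq_sym.
by rewrite (bigD1 (s j)) //= !atE MM' mul0r.
Qed.

Lemma prod_scalemx d (I : Type) (s : seq I) (c : I -> C) (M : I -> 'M[C]_d) :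
  \prod_(i <- s) (c i *: M i) = (\prod_(i <- s) c i) *: \prod_(i <- s) M i.
Proof.
elim: s => [|i s IHs]; first by rewrite !big_nil scale1r.
by rewrite !big_cons IHs -!mulmxE -scalemxAl -scalemxAr scalerA.
Qed.

(** Indexing by natural numbers gives a meaning to [B j.+1] at the last factor, where an ordinal
    would run out. *)
Lemma prod_telescope d (M B : nat -> 'M[C]_d) n :
    (forall j, B j \is unitarymx) ->
  \prod_(j < n) ((B j)^t* *m M j *m B j.+1) = (B 0)^t* *m (\prod_(j < n) M j) *m B n.
Proof.
move=> uB; elim: n => [|n IHn].
  by rewrite !big_ord0 mulmx1 unitarymx_adjmxM.
rewrite !big_ord_recr /= IHn -!mulmxE !mulmxA; congr (_ *m _ *m _).
by rewrite mulmxtVK.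
Qed.

Lemma prod_unitary d N (K : 'I_N -> 'M[C]_d) :
  (forall j, K j \is unitarymx) -> \prod_j K j \is unitarymx.
Proof.
move=> uK; apply: (big_ind (fun M : 'M[C]_d => M \is unitarymx)) => [|M L uM uL|j _].
- exact: unitarymx1.
- exact: mul_unitarymx.
- exact: uK.
Qed.

Lemma hsdot_unitary_mulr m n (U : 'M[C]_n) (A B : 'M[C]_(m, n)) :
  U \is unitarymx -> hsdot (A *m U) (B *m U) = hsdot A B.
Proof.
move=> uU; rewrite /hsdot adjmxM mxtrace_mulC !mulmxA mulmxtVK //.
by rewrite mxtrace_mulC.
Qed.

(* The unitaries P j undo the local unitaries around the j-th Pauli matrix and
   those left over by the previous gate, and move qubit a j to a fresh slot. *)
Lemma interleaving_unitaries n N (a : 'I_N -> 'I_n)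
    (V W : 'I_N -> 'M[C]_2) (c : 'I_N -> 'I_4 -> C) (S : 'I_N -> 'I_4 -> 'M[C]_(qdim n)) :
    (N <= n)%N ->
    (forall j, V j \is unitarymx) -> (forall j, W j \is unitarymx) ->
    (forall j k, `|c j k| = 1) ->
    (forall j k, S j k = c j k *: at_qubit (a j) (V j *m pauli R k *m W j)) ->
  exists2 P : 'I_N -> 'M[C]_(qdim n), forall j, P j \is unitarymx &
    forall k l : {ffun 'I_N -> 'I_4},
      hsdot (\prod_j (P j *m S j (k j))) (\prod_j (P j *m S j (l j))) =
      (qdim n)%:R * (k == l)%:R.
Proof.
move=> leNn uV uW c1 eS; pose s := widen_ord leNn.
have s_inj : injective s by move=> i j [] /val_inj.
have [Q uQ eQ] : exists2 Q : 'I_N -> 'M[C]_(qdim n),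
    forall j, Q j \is unitarymx &
    forall j L, Q j *m at_qubit (a j) L *m (Q j)^t* = at_qubit (s j) L.
  have ex j : exists Q : 'M[C]_(qdim n), Q \is unitarymx /\
      forall L, Q *m at_qubit (a j) L *m Q^t* = at_qubit (s j) L.
    by have [Q uQ eQ] := permute_at_qubit (s j) (a j); exists Q.
  by have [Q eQ] := fin_all_exists ex; exists Q => j; case: (eQ j).
(* [A j] and [B j] collect the local unitaries of gate j and the move to its slot: up to a phase,
   [S j k] is [A j], a Pauli matrix on slot [s j], then [B j]. *)
pose A j := at_qubit (a j) (V j) *m (Q j)^t*.
pose B j := Q j *m at_qubit (a j) (W j).
have uA j : A j \is unitarymx.
  by rewrite mul_unitarymx ?at_qubit_unitary // trmxC_unitary.
have uB j : B j \is unitarymx by rewrite mul_unitarymx ?at_qubit_unitary.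
have SE j k : S j k = c j k *: (A j *m at_qubit (s j) (pauli R k) *m B j).
  rewrite eS -eQ /A /B !mulmxA; congr (_ *: _).
  rewrite mulmxKtV // mulmxKtV //.
  by rewrite !at_qubitM.
(* Shift by one: [natB j.+1] is [B j] and [natB 0] is the identity. So [P j] removes [A j] on its
   right and the [B] of the factor to its left in the product; for j = 0 there is none to remove. *)
clearbody A B; pose natB n' := if n' is n''.+1 then oapp B 1%:M (insub n'') else 1%:M.
have unatB j : natB j \is unitarymx.
  by case: j => [|j] /=; [|case: insub => [?|] /=]; rewrite ?unitarymx1.
pose P (j : 'I_N) := (natB j)^t* *m (A j)^t*.
have uP j : P j \is unitarymx by rewrite mul_unitarymx ?trmxC_unitary.
exists P => // k l.
have [<-|nkl] := eqVneq k l.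
  have uPS j : P j *m S j (k j) \is unitarymx.
    rewrite mul_unitarymx // SE; apply/unitarymxP.
    rewrite adjmxZ -scalemxAr -scalemxAl scalerA mulrC -normCK c1 expr1n scale1r.
    apply/unitarymxP; rewrite mul_unitarymx // mul_unitarymx //.
    by rewrite at_qubit_unitary // pauli_unitary.
  by rewrite /hsdot unitarymx_adjmxM ?prod_unitary // mxtrace1 mulr1.
rewrite mulr0.
have prodE (k' : {ffun 'I_N -> 'I_4}) : \prod_j (P j *m S j (k' j)) =
    (\prod_j c j (k' j)) *:
      ((\prod_j at_qubit (s j) (pauli R (k' j))) *m natB N).
  pose natM n' := oapp (fun j => at_qubit (s j) (pauli R (k' j))) 1%:M (insub n').
  have natME (j : 'I_N) : natM j = at_qubit (s j) (pauli R (k' j)).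
    by rewrite /natM valK.
  have natBE (j : 'I_N) : natB j.+1 = B j by rewrite /= valK.
  transitivity ((\prod_j c j (k' j)) *:
      \prod_(j < N) ((natB j)^t* *m natM j *m natB j.+1)).
    rewrite -prod_scalemx; apply: eq_bigr => j _.
    by rewrite SE natME natBE -scalemxAr /P !mulmxA mulmxKtV.
  rewrite prod_telescope // adjmx1 mul1mx; congr (_ *: (_ *m _)).
  by apply: eq_bigr => j _; apply: natME.
have [j nkj] : exists j, k j != l j.
  apply/existsP; apply: contraR nkl; rewrite negb_exists => /forallP eq_kl.
  by apply/eqP/ffunP => j; apply/eqP; move: (eq_kl j); rewrite negbK.
(* Only the phases and the last [natB N] survive the telescoping. The former are scalars, and the
   latter is a common unitary factor, so neither affects orthogonality. *)
rewrite !prodE hsdotZl hsdotZr hsdot_unitary_mulr //.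
by rewrite (string_orthogonal (j := j)) ?mulr0 // pauli_orthogonal.
Qed.

End Qubits.

(** * Controlled operations with an ancilla qubit *)

(* The matrix units |x><y| of a qubit in the basis (|0> +- |1>) / sqrt 2, so
   that the initial state |0><0| is a superposition of all of them. *)
HB.lock Definition flip_unit (R : realType) (x y : bool) : 'M[R[i]]_2 :=
  \matrix_(i, j) (2^-1 * ((-1) ^+ (x && (i != 0)) * (-1) ^+ (y && (j != 0)))).

(** For a hermitian involution [O], the spectral projection onto the eigenvalue [(-1) ^+ s]. *)
HB.lock Definition outcome_proj (R : realType) n (O : 'M[R[i]]_n) (s : bool) : 'M[R[i]]_n :=
  2^-1 *: (1%:M + (-1) ^+ s *: O).

Section UpperBound.
Variable R : realType.
Local Notation C := R[i].

(** Turns composition into a matrix product, so that distributivity of products over sums becomes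
    available for maps. Row vectors reverse the order of composition, and the transposes restore
    it. *)
Lemma mxvec_compose d (I : Type) (s : seq I) (f : I -> 'M[C]_d -> 'M[C]_d) y :
    (forall i, linear (f i)) ->
  (mxvec ((\big[(fun g h => g \o h)/id]_(i <- s) f i) y))^T =
  \prod_(i <- s) (lin_mx (f i))^T *m (mxvec y)^T.
Proof.
move=> lin_f; elim: s => [|i s IHs]; first by rewrite !big_nil mul1mx.
rewrite !big_cons /= -mulmxE -mulmxA -IHs -trmx_mul.
by have [f' ->] := linear_packed (lin_f i); rewrite mul_vec_lin.
Qed.

Lemma compose_multilinear d N (I : finType) (c : 'I_N -> I -> C)
    (g : 'I_N -> I -> 'M[C]_d -> 'M[C]_d) y :
    (forall j p, linear (g j p)) ->
  compose (fun j x => \sum_p c j p *: g j p x) y =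
  \sum_(phi : {ffun 'I_N -> I})
     (\prod_j c j (phi j)) *: compose (fun j => g j (phi j)) y.
Proof.
move=> lin_g; apply: (can_inj mxvecK); apply: trmx_inj.
rewrite mxvec_compose => [|j]; last first.
  move=> a x x'; rewrite scaler_sumr -big_split; apply: eq_bigr => p _.
  by rewrite lin_g scalerDr !scalerA mulrC.
have -> : \prod_j (lin_mx (fun x => \sum_p c j p *: g j p x))^T =
    \prod_j \sum_p c j p *: (lin_mx (g j p))^T.
  apply: eq_bigr => j _; apply/matrixP => k l; rewrite !mxE summxE /= linear_sum summxE.
  by apply: eq_bigr => p _; rewrite linearZ !mxE.
rewrite bigA_distr_bigA mulmx_suml !linear_sum; apply: eq_bigr => phi _.
by rewrite prod_scalemx !linearZ /= mxvec_compose // scalemxAl.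
Qed.

Lemma compose_intertwine (T T' : Type) N (h : T -> T') (f : 'I_N -> T -> T)
    (g : 'I_N -> T' -> T') :
  (forall j x, g j (h x) = h (f j x)) -> forall x, compose g (h x) = h (compose f x).
Proof.
move=> gh; rewrite /compose.
apply: (big_ind2 (fun (F : T -> T) (G : T' -> T') => forall x, G (h x) = h (F x))) => //.
by move=> F G F' G' FG FG' x; rewrite /= FG' FG.
Qed.

Local Notation flip_unit := (flip_unit R).

Lemma two_neq0 : (2 : C) != 0.
Proof. by rewrite pnatr_eq0. Qed.

Lemma flip_unitM x y z w :
  flip_unit x y *m flip_unit z w = (y == z)%:R *: flip_unit x w.
Proof.
have n2 := two_neq0.
apply/matrixP => i j; rewrite flip_unit.unlock mxE !big_ord_recl big_ord0 !mxE /=.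
by case: y; case: z; rewrite /= ?expr0 ?expr1; field.
Qed.

Lemma flip_unit_adj x y : (flip_unit x y)^t* = flip_unit y x.
Proof.
apply/matrixP => i j; rewrite flip_unit.unlock adjmxE !mxE !rmorphM !rmorph_sign fmorphV rmorph_nat.
by congr (_ * _); rewrite mulrC.
Qed.

Lemma flip_unit_tr x y : \tr (flip_unit x y) = (x == y)%:R.
Proof.
have n2 := two_neq0.
rewrite flip_unit.unlock /mxtrace !big_ord_recl big_ord0 !mxE /=.
by case: x; case: y; rewrite /= ?expr0 ?expr1; field.
Qed.

Lemma flip_unit_sum1 : \sum_x flip_unit x x = 1%:M.
Proof.
have n2 := two_neq0.
apply/matrixP => i j; rewrite flip_unit.unlock big_bool !mxE /=.
by case: i => [[|[|//]] ?]; case: j => [[|[|//]] ?]; rewrite /= ?expr0 ?expr1; field.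
Qed.

Lemma flip_unit_init : delta_mx 0 0 = 2^-1 *: \sum_x \sum_y flip_unit x y.
Proof.
have n2 := two_neq0.
apply/matrixP => i j; rewrite flip_unit.unlock !big_bool !mxE /=.
by case: i => [[|[|//]] ?]; case: j => [[|[|//]] ?]; rewrite /= ?expr0 ?expr1; field.
Qed.

(** In the basis of [flip_unit] this is the Pauli matrix X for z = 1 and -Y for z = 'i; the minus
    sign is harmless since both ancillas are measured with the same z. *)
Definition observable (z : C) : 'M[C]_2 :=
  z *: flip_unit false true + z^*%R *: flip_unit true false.

Lemma observable_adj z : (observable z)^t* = observable z.
Proof. by rewrite adjmxD !adjmxZ !flip_unit_adj conjCK addrC. Qed.

Lemma observable_sqr z : `|z| = 1 -> observable z *m observable z = 1%:M.
Proof.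
move=> z1; have zz : z * z^*%R = 1 by rewrite -normCK z1 expr1n.
rewrite mulmxDl !mulmxDr -!scalemxAl -!scalemxAr !flip_unitM /= !scale0r !scaler0.
rewrite !scale1r !scalerA [_^*%R * z]mulrC zz !scale1r addr0 add0r.
by rewrite -flip_unit_sum1 big_bool addrC.
Qed.

Lemma observable_tr z x y : \tr (observable z *m flip_unit x y) =
  (~~ y && x)%:R * z + (y && ~~ x)%:R * z^*%R.
Proof.
rewrite mulmxDl -!scalemxAl !flip_unitM !scalerA mxtraceD !mxtraceZ !flip_unit_tr.
by case: x; case: y; rewrite /= ?mulr0 ?mulr1 ?mul0r ?mul1r.
Qed.

Section SignedMeasurement.
Variables (n : nat) (O : 'M[C]_n).
Hypotheses (adjO : O^t* = O) (sqrO : O *m O = 1%:M).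

Local Notation outcome_proj := (outcome_proj O).

Lemma outcome_proj_adj s : (outcome_proj s)^t* = outcome_proj s.
Proof.
by rewrite outcome_proj.unlock adjmxZ adjmxD adjmxZ adjmx1 adjO rmorph_sign fmorphV rmorph_nat.
Qed.

Lemma outcome_proj_idem s : outcome_proj s *m outcome_proj s = outcome_proj s.
Proof.
rewrite outcome_proj.unlock -scalemxAl -scalemxAr mulmxDl !mulmxDr -!scalemxAl -!scalemxAr.
rewrite sqrO !mul1mx !mulmx1 [in _ *: (_ *: 1%:M)]scalerA -expr2 sqrr_sign.
rewrite scale1r [_ + 1%:M]addrC -mulr2n -[(_ + _) *+ 2]scaler_nat !scalerA.
by congr (_ *: _); have := two_neq0 => n2; field.
Qed.

(* Only the first map of the composition, which acts last, reads the ancilla: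
   it measures the observable O and multiplies by the outcome. *)
Definition ancilla_kraus (last s : bool) : 'M[C]_n :=
  if last then outcome_proj s else (~~ s)%:R%:M.

Definition ancilla_map last (e : 'M[C]_n) : 'M[C]_n :=
  sandwich (ancilla_kraus last false) (ancilla_kraus last false) e -
  sandwich (ancilla_kraus last true) (ancilla_kraus last true) e.

Lemma outcome_projD : outcome_proj false + outcome_proj true = 1%:M.
Proof.
rewrite outcome_proj.unlock -scalerDr expr0 expr1 scaleN1r scale1r addrACA subrr addr0 -mulr2n.
by rewrite -[1%:M *+ 2]scaler_nat scalerA mulVf ?two_neq0 // scale1r.
Qed.

Lemma outcome_projB : outcome_proj false - outcome_proj true = O.
Proof.
rewrite outcome_proj.unlock -scalerBr expr0 expr1 scaleN1r scale1r opprD opprK addrACA subrr add0r.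
by rewrite -mulr2n -[O *+ 2]scaler_nat scalerA mulVf ?two_neq0 // scale1r.
Qed.

Lemma ancilla_kraus_complete last :
  (ancilla_kraus last false)^t* *m ancilla_kraus last false +
  (ancilla_kraus last true)^t* *m ancilla_kraus last true = 1%:M.
Proof.
case: last => /=; last by rewrite adjmx1 mulmx1 raddf0 mulmx0 addr0.
by rewrite !outcome_proj_adj !outcome_proj_idem outcome_projD.
Qed.

Lemma ancilla_map_id e : ancilla_map false e = e.
Proof.
by rewrite /ancilla_map /= sandwich1 /sandwich raddf0 mul0mx mul0mx subr0.
Qed.

Lemma ancilla_map_tr e : \tr (ancilla_map true e) = \tr (O *m e).
Proof.
rewrite /ancilla_map /= /sandwich raddfB /= !outcome_proj_adj.
rewrite ![\tr (_ *m e *m _)]mxtrace_mulC !mulmxA !outcome_proj_idem.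
by rewrite -[LHS](raddfB (@mxtrace _ _)) -mulmxBl outcome_projB.
Qed.

End SignedMeasurement.

(** Apply [S x] controlled on ancilla state x, then [M] to the ancilla. *)
Definition ctrl_kraus d (S : bool -> 'M[C]_d) (M : 'M[C]_2) : 'M[C]_(d * 2) :=
  \sum_x S x *t (M *m flip_unit x x).

Definition ctrl_op d (S : bool -> 'M[C]_d) (O : 'M[C]_2) last (rho : 'M[C]_(d * 2)) :=
  sandwich (ctrl_kraus S (ancilla_kraus O last false))
    (ctrl_kraus S (ancilla_kraus O last false)) rho -
  sandwich (ctrl_kraus S (ancilla_kraus O last true))
    (ctrl_kraus S (ancilla_kraus O last true)) rho.

Lemma ctrl_kraus_adjM d (S : bool -> 'M[C]_d) M :
  (ctrl_kraus S M)^t* *m ctrl_kraus S M =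
  \sum_x \sum_y ((S x)^t* *m S y) *t (flip_unit x x *m (M^t* *m M) *m flip_unit y y).
Proof.
rewrite /ctrl_kraus adjmx_sum mulmx_suml; apply: eq_bigr => x _.
rewrite mulmx_sumr; apply: eq_bigr => y _.
by rewrite adjmx_tens tensmx_mul adjmxM flip_unit_adj !mulmxA.
Qed.

Lemma signed_op_kraus d (K L : 'M[C]_d) :
  K^t* *m K + L^t* *m L = 1%:M -> signed_op (fun rho => sandwich K K rho - sandwich L L rho).
Proof.
move=> KL1; exists (sandwich K K), (sandwich L L).
split=> [|||rho]; [exact: is_cp_sandwich|exact: is_cp_sandwich| |by []].
split=> [|rho]; first by apply: is_cpD; apply: is_cp_sandwich.
rewrite mxtraceD mxtrace_mulC [X in _ + X]mxtrace_mulC !mulmxA -mxtraceD -mulmxDl.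
by rewrite KL1 mul1mx.
Qed.

Lemma ctrl_kraus_complete d (S : bool -> 'M[C]_d) (M M' : 'M[C]_2) :
    (forall x, S x \is unitarymx) -> M^t* *m M + M'^t* *m M' = 1%:M ->
  (ctrl_kraus S M)^t* *m ctrl_kraus S M +
  (ctrl_kraus S M')^t* *m ctrl_kraus S M' = 1%:M.
Proof.
move=> uS MM'; rewrite !ctrl_kraus_adjM -big_split /=.
under eq_bigr do rewrite -big_split /=.
under eq_bigr do under eq_bigr do
  rewrite -tensmxDr -mulmxDl -mulmxDr MM' mulmx1 flip_unitM.
rewrite -(tensmx11 _ d 2) -flip_unit_sum1 tensmx_sumr; apply: eq_bigr => x _.
rewrite (bigD1 x) //= eqxx scale1r unitarymx_adjmxM // big1 ?addr0 // => y nyx.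
by rewrite eq_sym (negPf nyx) scale0r tensmx0.
Qed.

Lemma ctrl_op_signed d (S : bool -> 'M[C]_d) (O : 'M[C]_2) last :
  O^t* = O -> O *m O = 1%:M -> (forall x, S x \is unitarymx) ->
  signed_op (ctrl_op S O last).
Proof.
move=> adjO sqrO uS; apply: signed_op_kraus; apply: ctrl_kraus_complete => //.
exact: ancilla_kraus_complete.
Qed.

(** The ancilla unit |x><y| records which operator acts on the left and which on the right, and the
    state stays a product with the ancilla. Black boxes act on the other factor only, so this label
    survives them. *)
Lemma ctrl_kraus_unit d (S : bool -> 'M[C]_d) M sigma x y :
  sandwich (ctrl_kraus S M) (ctrl_kraus S M) (sigma *t flip_unit x y) =
  sandwich (S x) (S y) sigma *t sandwich M M (flip_unit x y).
Proof.
rewrite /sandwich /ctrl_kraus adjmx_sum mulmx_suml.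
have collapse X : \sum_x' (X x' : 'M[C]_(d * 2)) = X x + X (~~ x).
  by rewrite big_bool; case: (x); rewrite //= addrC.
have -> : \sum_x' (S x' *t (M *m flip_unit x' x')) *m (sigma *t flip_unit x y) =
    (S x *m sigma) *t (M *m flip_unit x y).
  rewrite collapse !tensmx_mul -!mulmxA !flip_unitM eqxx scale1r.
  by case: (x); rewrite scale0r mulmx0 tensmx0 addr0.
rewrite mulmx_sumr (bigD1 y) //= big1 => [|y' /negPf ny]; last first.
  rewrite adjmx_tens tensmx_mul adjmxM flip_unit_adj mulmxA -[_ *m flip_unit y' y']mulmxA.
  by rewrite flip_unitM eq_sym ny scale0r mulmx0 mul0mx tensmx0.
rewrite addr0 adjmx_tens tensmx_mul adjmxM flip_unit_adj.
by rewrite mulmxA -[_ *m flip_unit y y]mulmxA flip_unitM eqxx scale1r.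
Qed.

Lemma ctrl_op_unit d (S : bool -> 'M[C]_d) (O : 'M[C]_2) last sigma x y :
  ctrl_op S O last (sigma *t flip_unit x y) =
  sandwich (S x) (S y) sigma *t ancilla_map O last (flip_unit x y).
Proof.
rewrite /ctrl_op !ctrl_kraus_unit /ancilla_map.
by apply/matrixP => i j; rewrite !mxE mulrBr.
Qed.

Lemma ctrl_op_linear d (S : bool -> 'M[C]_d) (O : 'M[C]_2) last : linear (ctrl_op S O last).
Proof.
move=> c x y; rewrite /ctrl_op sandwich_linear [X in _ - X]sandwich_linear.
by rewrite opprD scalerBr addrACA.
Qed.

Definition with_anc dA dB eA eB (e : 'M[C]_eA) (f : 'M[C]_eB)
    (rho : 'M[C]_(dA * dB)) : 'M[C]_((dA * eA) * (dB * eB)) :=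
  reorder (rho *t (e *t f)).

Lemma with_anc_linear dA dB eA eB (e : 'M[C]_eA) (f : 'M[C]_eB) :
  linear (@with_anc dA dB eA eB e f).
Proof.
by move=> c x y; rewrite /with_anc tensmxDl tensmxZl reorder_linear.
Qed.

Lemma on_AB_with_anc dA dB eA eB X (e : 'M[C]_eA) (f : 'M[C]_eB) rho :
  linear X -> on_AB X (@with_anc dA dB eA eB e f rho) = with_anc e f (X rho).
Proof. by move=> lX; rewrite /on_AB reorderK tensmapE. Qed.

Lemma trace_anc_with_anc dA dB eA eB (e : 'M[C]_eA) (f : 'M[C]_eB) rho :
  trace_anc (@with_anc dA dB eA eB e f rho) = (\tr e * \tr f) *: rho.
Proof. by rewrite /trace_anc reorderK ptrace2_tens mxtrace_tens. Qed.

Lemma ctrl_ops_with_anc dA dB (S : bool -> 'M[C]_dA) (T : bool -> 'M[C]_dB) O last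
    x y x' y' rho :
  tensmap (ctrl_op S O last) (ctrl_op T O last)
    (with_anc (flip_unit x y) (flip_unit x' y') rho) =
  with_anc (ancilla_map O last (flip_unit x y)) (ancilla_map O last (flip_unit x' y'))
    (sandwich (S x *t T x') (S y *t T y') rho).
Proof.
move: rho; apply: tens_ext => [||a b].
- exact: linear_comp (@tensmap_linear _ _ _ _ _ _ _) (@with_anc_linear _ _ _ _ _ _).
- exact: linear_comp (@with_anc_linear _ _ _ _ _ _) (@sandwich_linear _ _ _ _ _).
- rewrite /with_anc reorder_tens tensmapE; try exact: ctrl_op_linear.
  rewrite !ctrl_op_unit -tensmap_sandwich tensmapE; try exact: sandwich_linear.
  by rewrite reorder_tens.
Qed.

Lemma init_anc_flip dA dB (rho : 'M[C]_(dA * dB)) :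
  init_anc 1 1 rho = 4^-1 *: \sum_x \sum_y \sum_x' \sum_y'
    with_anc (flip_unit x y) (flip_unit x' y') rho.
Proof.
have [r er] := linear_packed (@reorder_linear R dA dB 2 2).
rewrite /init_anc /with_anc er flip_unit_init !(tensmxZl, tensmxZr) scalerA linearZ.
congr (_ *: _); first by have n2 := two_neq0; field.
rewrite !tensmx_suml tensmx_sumr linear_sum; apply: eq_bigr => x _.
rewrite tensmx_suml tensmx_sumr linear_sum; apply: eq_bigr => y _.
rewrite !tensmx_sumr linear_sum; apply: eq_bigr => x' _.
by rewrite !tensmx_sumr linear_sum.
Qed.

End UpperBound.

(** * Interference of two branches *)

Section Interference.
Variable R : realType.
Local Notation C := R[i].
Local Notation flip_unit := (flip_unit R).

Lemma compose_linear d N (f : 'I_N -> 'M[C]_d -> 'M[C]_d) :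
  (forall j, linear (f j)) -> linear (compose f).
Proof.
move=> lf; rewrite /compose; apply: (big_ind (fun g : 'M[C]_d -> 'M[C]_d => linear g)) => //.
by move=> F G lF lG; apply: linear_comp.
Qed.

Lemma composeS (T : Type) n (f : 'I_n.+1 -> T -> T) x :
  compose f x = f ord0 (compose (fun j => f (lift ord0 j)) x).
Proof. by rewrite /compose big_ord_recl. Qed.

Lemma on_AB_linear dA dB eA eB X : linear (@on_AB R dA dB eA eB X).
Proof.
apply: linear_comp (@reorder_linear _ _ _ _ _) _.
exact: linear_comp (@tensmap_linear _ _ _ _ _ _ _) (@reorder_linear _ _ _ _ _).
Qed.

Section CtrlCompose.
Variables (dA dB n : nat).
Variables (S : bool -> 'I_n.+1 -> 'M[C]_dA) (T : bool -> 'I_n.+1 -> 'M[C]_dB).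
Variable X : 'I_n.+1 -> 'M[C]_(dA * dB) -> 'M[C]_(dA * dB).
Hypothesis linX : forall j, linear (X j).

Definition ctrl_compose (O : 'M[C]_2) rho : 'M[C]_(dA * dB) :=
  trace_anc (compose (fun j => on_AB (X j) \o
      tensmap (ctrl_op (S^~ j) O (j == ord0)) (ctrl_op (T^~ j) O (j == ord0)))
    (init_anc 1 1 rho)).

(** [x], [x'] select the operators of A and B acting from the left, [y], [y'] those acting from the
    right. *)
Definition branch x y x' y' rho : 'M[C]_(dA * dB) :=
  compose (fun j => X j \o sandwich (S x j *t T x' j) (S y j *t T y' j)) rho.

Lemma ctrl_composeE O rho : O^t* = O -> O *m O = 1%:M ->
  ctrl_compose O rho = 4^-1 *: \sum_x \sum_y \sum_x' \sum_y'
    (\tr (O *m flip_unit x y) * \tr (O *m flip_unit x' y')) *: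
      branch x y x' y' rho.
Proof.
move=> adjO sqrO; rewrite /ctrl_compose; set F := fun j => _ \o _.
have lF j : linear (F j).
  exact: linear_comp (@on_AB_linear _ _ _ _ _) (@tensmap_linear _ _ _ _ _ _ _).
have [g eg] := linear_packed
  (linear_comp (@trace_anc_linear R dA dB 2 2) (compose_linear lF)).
have gE sigma : trace_anc (compose F sigma) = g sigma by rewrite -eg.
rewrite gE init_anc_flip linearZ linear_sum; congr (_ *: _).
apply: eq_bigr => x _; rewrite linear_sum; apply: eq_bigr => y _.
rewrite linear_sum; apply: eq_bigr => x' _.
rewrite linear_sum; apply: eq_bigr => y' _.
rewrite -gE composeS.
(* No measurement takes place inside the outermost map, so the ancilla units pass unchanged and
   [with_anc] intertwines the two compositions. *)
rewrite (compose_intertwine (f := fun j => X (lift ord0 j) \o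
   sandwich (S x (lift ord0 j) *t T x' (lift ord0 j))
     (S y (lift ord0 j) *t T y' (lift ord0 j)))) => [|j sigma]; last first.
  rewrite /F /= ctrl_ops_with_anc on_AB_with_anc // eq_sym (negPf (neq_lift _ _)).
  by rewrite !ancilla_map_id.
rewrite /F /= ctrl_ops_with_anc on_AB_with_anc // trace_anc_with_anc eqxx.
by congr ((_ * _) *: _); [apply: ancilla_map_tr|apply: ancilla_map_tr|rewrite /branch composeS].
Qed.

(** The observable has zero diagonal, which leaves four of the sixteen branches; in the two mixed
    ones the phases p and q cancel. *)
Lemma sum_offdiag (V : lmodType C) (p q : C) (o : bool -> bool -> C)
    (Z : bool -> bool -> bool -> bool -> V) :
    (forall x, o x x = 0) -> o false true = p -> o true false = q -> p * q = 1 ->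
  \sum_x \sum_y \sum_x' \sum_y' (o x y * o x' y') *: Z x y x' y' =
  (p * p) *: Z false true false true +
  (Z false true true false + Z true false false true) +
  (q * q) *: Z true false true false.
Proof.
move=> o0 op oq pq; rewrite !big_bool /= !o0 op oq [q * p]mulrC pq !scale1r.
rewrite !(mul0r, mulr0, scale0r, addr0, add0r).
by rewrite addrC [X in X + _]addrC -!addrA; congr (_ + (_ + _)); rewrite addrC.
Qed.

Lemma ctrl_compose_observable z rho : `|z| = 1 ->
  ctrl_compose (observable z) rho = 4^-1 *:
    ((z^*%R * z^*%R) *: branch false true false true rho +
     (branch false true true false rho + branch true false false true rho) +
     (z * z) *: branch true false true false rho).
Proof.
move=> z1; rewrite ctrl_composeE; last 2 first.
- exact: observable_adj.
- exact: observable_sqr.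
pose o x y : C := if x == y then 0 else if x then z else z^*%R.
have trE x y : \tr (observable z *m flip_unit x y) = o x y.
  rewrite observable_tr /o.
  by case: x; case: y; rewrite /= ?mul0r ?mul1r ?addr0 ?add0r.
have zz : z * z^*%R = 1 by rewrite -normCK z1 expr1n.
have zz' : z^*%R * z = 1 by rewrite mulrC.
transitivity (4^-1 *: \sum_x \sum_y \sum_x' \sum_y'
    (o x y * o x' y') *: branch x y x' y' rho).
  congr (_ *: _); do 4![apply: eq_bigr => ? _].
  by congr ((_ * _) *: _); apply: trE.
congr (_ *: _); apply: sum_offdiag => [x||//|]; rewrite /o ?eqxx //.
Qed.

(** The wanted branches carry the square of z or of its conjugate, which is 1 for z = 1 and -1 for z
    = 'i. The mixed part b has no phase and drops out of the difference. *)
Lemma phase_cancel (V : lmodType C) (a b d v w : V) :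
    v = 4^-1 *: (((1 : C)^*%R * 1^*%R) *: a + b + ((1 : C) * 1) *: d) ->
    w = 4^-1 *: ((('i%C : C)^*%R * 'i%C^*%R) *: a + b + (('i%C : C) * 'i%C) *: d) ->
  v - w = 2^-1 *: (a + d).
Proof.
have ii : 'i%C * 'i%C = -1 :> C by rewrite -expr2 sqr_i.
move=> -> ->; rewrite -!rmorphM ii mulr1 rmorphN1 rmorph1 -scalerBr.
rewrite !scaleN1r !scale1r opprB opprD opprK.
have -> : a + b + d + (d + (a - b)) = 2 *: (a + d).
  rewrite scaler_nat mulr2n [a + b + d]addrAC -[LHS]addrA; congr (_ + _).
  by rewrite addrCA [b + _]addrC subrK addrC.
by rewrite scalerA; congr (_ *: _); have n2 := two_neq0 R; field.
Qed.

Lemma four_equal (V : lmodType C) (a b c d v : V) :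
    v = 4^-1 *: (((1 : C)^*%R * 1^*%R) *: a + (b + c) + ((1 : C) * 1) *: d) ->
    a = d -> b = d -> c = d ->
  v = 2^-1 *: (a + d).
Proof.
move=> -> -> -> ->; rewrite -rmorphM mulr1 rmorph1 !scale1r.
have -> : d + (d + d) + d = 2 *: (d + d) by rewrite scaler_nat mulr2n !addrA.
by rewrite scalerA; congr (_ *: _); have n2 := two_neq0 R; field.
Qed.

Lemma normCi : `|'i%C : C| = 1.
Proof.
have ci : ('i%C : C)^*%R = - 'i%C by simpc.
apply/eqP; rewrite -(eqrXn2 (n := 2)) // ?normr_ge0 //.
by rewrite normCK ci mulrN -expr2 sqr_i opprK expr1n.
Qed.

Lemma ctrl_compose_interference rho :
  ctrl_compose (observable (1 : C)) rho - ctrl_compose (observable ('i%C : C)) rho =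
  2^-1 *: (branch false true false true rho + branch true false true false rho).
Proof.
exact: phase_cancel (ctrl_compose_observable rho (normr1 _))
  (ctrl_compose_observable rho normCi).
Qed.

(** For equal strings all four branches coincide, so there is nothing to cancel and the second
    measurement is saved; this keeps the diagonal cost at the square of the weight. *)
Lemma ctrl_compose_diagonal rho : S false =1 S true -> T false =1 T true ->
  ctrl_compose (observable (1 : C)) rho =
  2^-1 *: (branch false true false true rho + branch true false true false rho).
Proof.
move=> eS eT; apply: four_equal (ctrl_compose_observable rho (normr1 _)) _ _ _;
  by apply: eq_compose => j sigma /=; rewrite ?eS ?eT.
Qed.

End CtrlCompose.

End Interference.

(** * LO decompositions *)

Section Decomposition.
Variable R : realType.
Local Notation C := R[i].

Lemma bb_decomposition_finType S dA dB N (E : 'I_N -> 'M[C]_(dA * dB) -> 'M[C]_(dA * dB))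
    eA eB (L : finType) (a : L -> R) F :
    (0 < #|L|)%N -> (forall l j, S (dA * eA.+1)%N (dB * eB.+1)%N (F l j)) ->
    (forall X : 'I_N -> 'M[C]_(dA * dB) -> 'M[C]_(dA * dB),
        (forall j, is_cptp (X j)) -> forall rho,
      compose (fun j => X j \o E j) rho =
      \sum_l (a l)%:C *:
        trace_anc (compose (fun j => on_AB (X j) \o F l j) (init_anc eA eB rho))) ->
  exists m (a' : 'I_m -> R) F',
    bb_decomposition S E (eA := eA) (eB := eB) a' F' /\ \sum_i `|a' i| = \sum_l `|a l|.
Proof.
move=> L0 SF dec; exists #|L|, (fun i => a (enum_val i)), (fun i => F (enum_val i)).
split; last by rewrite -(big_enum_val (fun l => `|a l|)).
split=> // X cX rho; rewrite dec //.
have [t et] := linear_packed (@trace_anc_linear R dA dB eA.+1 eB.+1).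
have tE sigma : trace_anc sigma = t sigma by rewrite -et.
rewrite tE linear_sum (big_enum_val (fun l => (a l)%:C *:
  trace_anc (compose (fun j => on_AB (X j) \o F l j) (init_anc eA eB rho)))).
by apply: eq_bigr => i _; rewrite linearZ tE.
Qed.

Lemma sqr_sum_offdiag (I : finType) (r : I -> R) :
  (\sum_k r k) ^+ 2 = \sum_k r k ^+ 2 + \sum_k \sum_(k' | k' != k) r k * r k'.
Proof.
rewrite expr2 mulr_suml -big_split; apply: eq_bigr => k _.
by rewrite mulr_sumr (bigD1 k) //= expr2.
Qed.

(* Coherent superposition of the strings k (ancilla value false) and k'
   (ancilla value true). *)
Definition string_pair (J T : Type) N (f : 'I_N -> J -> T) (k k' : 'I_N -> J)
    (x : bool) (j : 'I_N) : T :=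
  f j (if x then k' j else k j).

Lemma compose_conj_channel_sum dA dB N (J : finType) (r : 'I_N -> J -> R)
    (S : 'I_N -> J -> 'M[C]_dA) (T : 'I_N -> J -> 'M[C]_dB)
    (X : 'I_N -> 'M[C]_(dA * dB) -> 'M[C]_(dA * dB)) rho :
    (forall j, linear (X j)) ->
  compose (fun j => X j \o conj_channel (\sum_k (r j k)%:C *: (S j k *t T j k))) rho =
  \sum_(k : {ffun 'I_N -> J}) \sum_(k' : {ffun 'I_N -> J})
    (\prod_j r j (k j) * \prod_j r j (k' j))%:C *:
    compose (fun j => X j \o
      sandwich (S j (k j) *t T j (k j)) (S j (k' j) *t T j (k' j))) rho.
Proof.
move=> linX.
pose c j (p : J * J) := (r j p.1 * r j p.2)%:C : C.
pose g j (p : J * J) := X j \o sandwich (S j p.1 *t T j p.1) (S j p.2 *t T j p.2).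
transitivity (compose (fun j x => \sum_p c j p *: g j p x) rho).
  apply: eq_compose => j sigma; rewrite /g /=.
  have [x ex] := linear_packed (linX j); rewrite ex.
  have -> : conj_channel (\sum_k (r j k)%:C *: (S j k *t T j k)) sigma =
      \sum_k \sum_k' c j (k, k') *: sandwich (S j k *t T j k) (S j k' *t T j k') sigma.
    rewrite /conj_channel adjmx_sum !mulmx_suml; apply: eq_bigr => k _.
    rewrite mulmx_sumr; apply: eq_bigr => k' _.
    rewrite adjmxZ -!scalemxAl -scalemxAr scalerA /c /= rmorphM /=.
    by congr (_ * _ *: _); exact: conjc_real.
  rewrite pair_big linear_sum; apply: eq_bigr => -[k k'] _ /=.
  by rewrite linearZ.
rewrite compose_multilinear => [|j p]; last first.
  by apply: linear_comp => //; apply: sandwich_linear.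
rewrite pair_big /=.
(* A function into pairs is a pair of functions: the strings acting from the left and from the
   right. *)
pose unpair (phi : {ffun 'I_N -> J * J}) : {ffun 'I_N -> J} * {ffun 'I_N -> J} :=
  ([ffun j => (phi j).1], [ffun j => (phi j).2]).
rewrite [RHS](reindex unpair) /=; last first.
  exists (fun kk : {ffun 'I_N -> J} * {ffun 'I_N -> J} =>
    [ffun j => (kk.1 j, kk.2 j)]) => [phi _|[k k'] _].
    by apply/ffunP => j; rewrite !ffunE /= -surjective_pairing.
  by congr (_, _); apply/ffunP => j; rewrite !ffunE.
apply: eq_bigr => phi _; apply: (congr2 (fun a M => a *: M)).
  rewrite -big_split rmorph_prod; apply: eq_bigr => j _.
  by rewrite /c !ffunE.
by apply: eq_compose => j sigma; rewrite /g /= !ffunE.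
Qed.

(** The ancilla measurement only yields an interference term together with its mirror image.
    Symmetric weights make this sufficient. *)
Lemma sum_symmetrize (V : lmodType C) (I : finType) (c : I -> I -> C) (D : I -> I -> V) :
    (forall k k', c k k' = c k' k) ->
  \sum_k \sum_k' c k k' *: D k k' =
  \sum_k \sum_k' c k k' *: (2^-1 *: (D k k' + D k' k)).
Proof.
move=> cC; set s := LHS.
have s' : s = \sum_k \sum_k' c k k' *: D k' k.
  rewrite /s exchange_big; apply: eq_bigr => k _; apply: eq_bigr => k' _.
  by rewrite cC.
transitivity (2^-1 *: (s + s)).
  by rewrite -mulr2n -[s *+ 2]scaler_nat scalerA mulVf ?two_neq0 // scale1r.
rewrite [X in _ *: (_ + X)]s' -big_split scaler_sumr; apply: eq_bigr => k _ /=.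
rewrite -big_split scaler_sumr; apply: eq_bigr => k' _ /=.
by rewrite -scalerDr !scalerA mulrC.
Qed.

Lemma LO_decomposition dA dB n (J : finType) (r : 'I_n.+1 -> J -> R)
    (S : 'I_n.+1 -> J -> 'M[C]_dA) (T : 'I_n.+1 -> J -> 'M[C]_dB)
    (E : 'I_n.+1 -> 'M[C]_(dA * dB) -> 'M[C]_(dA * dB))
    (w := fun k : {ffun 'I_n.+1 -> J} => \prod_j r j (k j)) :
    (forall j k, 0 <= r j k) -> \sum_k w k ^+ 2 = 1 ->
    (forall j k, S j k \is unitarymx) -> (forall j k, T j k \is unitarymx) ->
    (forall j, E j = conj_channel (\sum_k (r j k)%:C *: (S j k *t T j k))) ->
  exists m (a : 'I_m -> R) F,
    bb_decomposition (@LO R) E (eA := 1) (eB := 1) a F /\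
    \sum_i `|a i| = 1 + 2 * \sum_k \sum_(k' | k' != k) w k * w k'.
Proof.
move=> r0 r1 uS uT eE; pose JN := {ffun 'I_n.+1 -> J}.
have w0 k : 0 <= w k by apply: prodr_ge0.
pose z (b : bool) : C := if b then 'i%C else 1.
have z1 b : `|z b| = 1 by case: b; rewrite /z ?normCi ?normr1.
(* The boolean selects the measurement: X (x) X with weight w_k w_k', or Y (x) Y with the opposite
   weight, which is set to 0 when the strings agree. *)
pose a (l : JN * JN * bool) : R :=
  w l.1.1 * w l.1.2 * (if l.2 then - (l.1.1 != l.1.2)%:R else 1).
pose F (l : JN * JN * bool) (j : 'I_n.+1) :=
  tensmap (ctrl_op (string_pair S l.1.1 l.1.2 ^~ j) (observable (z l.2)) (j == ord0))
          (ctrl_op (string_pair T l.1.1 l.1.2 ^~ j) (observable (z l.2)) (j == ord0)).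
have sum_a : \sum_l `|a l| = 1 + 2 * \sum_k \sum_(k' | k' != k) w k * w k'.
  rewrite -(pair_big xpredT xpredT (fun (kk : JN * JN) b => `|a (kk, b)|)) /=.
  rewrite -(pair_big xpredT xpredT (fun k k' => \sum_b `|a (k, k', b)|)) /=.
  transitivity (\sum_k (w k ^+ 2 + 2 * \sum_(k' | k' != k) w k * w k')); last first.
    by rewrite big_split /= r1 mulr_sumr.
  apply: eq_bigr => k _ /=.
  rewrite (bigD1 k) //= big_bool /a /= eqxx oppr0 mulr0 normr0 add0r mulr1.
  rewrite ger0_norm ?mulr_ge0 // -expr2 mulr_sumr; congr (_ + _).
  apply: eq_bigr => k' nk; rewrite big_bool /= [k == k']eq_sym nk mulrN1 normrN mulr1.
  by rewrite ger0_norm ?mulr_ge0 // mulr_natl.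
have [||X cX rho|m [a' [F' [dec suma]]]] :=
    @bb_decomposition_finType (@LO R) dA dB n.+1 E 1 1 _ a F; last first.
- by exists m, a', F'; rewrite suma.
- have linX j : linear (X j) by case: (cX j) => -[].
  rewrite (eq_compose (g := fun j => X j \o
    conj_channel (\sum_k (r j k)%:C *: (S j k *t T j k)))); last by move=> j x; rewrite /= eE.
  rewrite compose_conj_channel_sum //.
  rewrite -(pair_big xpredT xpredT (fun (kk : JN * JN) b => (a (kk, b))%:C *:
    trace_anc (compose (fun j => on_AB (X j) \o F (kk, b) j) (init_anc 1 1 rho)))) /=.
  rewrite -(pair_big xpredT xpredT (fun (k k' : JN) => \sum_b (a (k, k', b))%:C *:
    trace_anc (compose (fun j => on_AB (X j) \o F (k, k', b) j) (init_anc 1 1 rho)))) /=.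
  pose D (k k' : JN) := compose (fun j => X j \o
      sandwich (S j (k j) *t T j (k j)) (S j (k' j) *t T j (k' j))) rho.
  transitivity (\sum_(k : JN) \sum_(k' : JN)
      (w k * w k')%:C *: (2^-1 *: (D k k' + D k' k))).
    apply: (sum_symmetrize D) => k k'.
    by rewrite mulrC.
  apply: eq_bigr => k _; apply: eq_bigr => k' _.
  pose V O := ctrl_compose (string_pair S k k') (string_pair T k k') X O rho.
  transitivity ((a (k, k', true))%:C *: V (observable ('i%C : C)) +
    (a (k, k', false))%:C *: V (observable (1 : C))); last by rewrite big_bool.
  rewrite /a /=; have [ekk|nkk] := eqVneq k k'.
    have eS : string_pair S k k' false =1 string_pair S k k' true.
      by move=> j; rewrite /string_pair ekk.
    have eT : string_pair T k k' false =1 string_pair T k k' true.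
      by move=> j; rewrite /string_pair ekk.
    rewrite oppr0 mulr0 rmorph0 scale0r add0r mulr1.
    congr (_ *: _); apply/esym; exact: (ctrl_compose_diagonal linX rho eS eT).
  rewrite mulrN1 mulr1 rmorphN /= scaleNr [RHS]addrC -scalerBr.
  congr (_ *: _); apply/esym; exact: (ctrl_compose_interference _ _ linX rho).
- move=> l j; exists (ctrl_op (string_pair S l.1.1 l.1.2 ^~ j) (observable (z l.2)) (j == ord0)).
  exists (ctrl_op (string_pair T l.1.1 l.1.2 ^~ j) (observable (z l.2)) (j == ord0)).
  split=> //; apply: ctrl_op_signed; rewrite ?observable_adj ?observable_sqr //;
    by move=> x; rewrite /string_pair.
- apply/card_gt0P; have [k _] : exists k : JN, w k != 0.
    apply/existsP; apply: contraT; rewrite negb_exists => /forallP wk0.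
    suff: \sum_k w k ^+ 2 = 0 by rewrite r1 => /eqP; rewrite oner_eq0.
    by rewrite big1 // => k _; move: (wk0 k); rewrite negbK => /eqP ->; rewrite expr0n.
  by exists (k, k, true).
Qed.

(** With no gate there is no local operation that could carry the ancilla measurement; a single term
    of weight 1 already reproduces the empty composition. *)
Lemma trivial_decomposition S dA dB
    (E : 'I_0 -> 'M[C]_(dA * dB) -> 'M[C]_(dA * dB)) :
  exists m (a : 'I_m -> R) F,
    bb_decomposition S E (eA := 0) (eB := 0) a F /\ \sum_i `|a i| = 1.
Proof.
have [||X cX rho|m [a [F [dec suma]]]] := @bb_decomposition_finType S dA dB 0 E 0 0
    unit (fun=> 1) (fun _ _ => id); last first.
- by exists m, a, F; rewrite suma (big_pred1 tt) => [|[]//]; rewrite normr1.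
- rewrite (big_pred1 tt) => [|[]//]; rewrite scale1r /compose !big_ord0.
  have tr1 : \tr (delta_mx 0 0 : 'M[C]_1) = 1 by rewrite /mxtrace big_ord1 mxE.
  by rewrite trace_anc_with_anc tr1 mulr1 scale1r.
- by move=> l [].
- by rewrite card_unit.
Qed.

End Decomposition.

(** * The optimal overhead *)

Section Overhead.
Variable R : realType.
Local Notation C := R[i].

Lemma LO_overhead dA dB N (J : finType) (r : 'I_N -> J -> R)
    (S : 'I_N -> J -> 'M[C]_dA) (T : 'I_N -> J -> 'M[C]_dB)
    (E : 'I_N -> 'M[C]_(dA * dB) -> 'M[C]_(dA * dB))
    (w := fun k : {ffun 'I_N -> J} => \prod_j r j (k j)) :
    (forall j k, 0 <= r j k) -> \sum_k w k ^+ 2 = 1 ->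
    (forall j k, S j k \is unitarymx) -> (forall j k, T j k \is unitarymx) ->
    (forall j, E j = conj_channel (\sum_k (r j k)%:C *: (S j k *t T j k))) ->
  exists eA eB m (a : 'I_m -> R) F,
    bb_decomposition (@LO R) E (eA := eA) (eB := eB) a F /\
    \sum_i `|a i| = 1 + 2 * \sum_k \sum_(k' | k' != k) w k * w k'.
Proof.
case: N r S T E @w => [|n] r S T E w r0 r1 uS uT eE; last first.
  by exists 1, 1; apply: LO_decomposition eE.
have [m [a [F [dec suma]]]] := trivial_decomposition (@LO R) E.
exists 0, 0, m, a, F; split=> //; rewrite suma big1 ?mulr0 ?addr0 // => k _.
by rewrite big_pred0 // => k'; apply/negbTE; rewrite negbK; apply/eqP/ffunP => -[].
Qed.

Lemma bb_decomposition_mono (S S' : forall m n, ('M[C]_(m * n) -> 'M[C]_(m * n)) -> Prop)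
    dA dB N E eA eB m (a : 'I_m -> R) F :
    (forall m n F, S m n F -> S' m n F) ->
  @bb_decomposition R S dA dB N E eA eB m a F -> bb_decomposition S' E a F.
Proof. by move=> SS' [m0 SF dec]; split=> // i j; apply: SS'. Qed.

Lemma qdim_gt0 n : (0 < qdim n)%N.
Proof. by rewrite /qdim card_ffun !card_ord expn_gt0. Qed.

(** The value 1 at zero keeps the modulus equal to 1, so that multiplication by a phase always
    preserves unitarity. *)
Definition phase (z : C) : C := if z == 0 then 1 else z / `|z|.

Lemma phase_norm z : `|phase z| = 1.
Proof.
rewrite /phase; case: eqVneq => [|z0]; first by rewrite normr1.
by rewrite normrM normfV normr_id mulfV // normr_eq0.
Qed.

Lemma phaseE z : z = (Normc.normc z)%:C * phase z.
Proof.
rewrite -[(Normc.normc z)%:C]/(`|z|) /phase; case: eqVneq => [->|z0].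
  by rewrite normr0 mul0r.
by rewrite mulrC divfK // normr_eq0.
Qed.

Lemma normc_prod (I : finType) (z : I -> C) :
  Normc.normc (\prod_i z i) = \prod_i Normc.normc (z i).
Proof. by apply: big_morph; [exact: Normc.normcM|exact: Normc.normc1]. Qed.

(** The phases of the KAK parameters go into the operators of B, which leaves nonnegative
    coefficients as both bounds require. *)
Lemma gate_on_KAK nA nB (a : 'I_nA) (b : 'I_nB) (u : 'I_4 -> C)
    (V1 V2 V3 V4 : 'M[C]_2) :
  gate_on a b ((V1 *t V2) *m (\sum_k u k *: (pauli R k *t pauli R k)) *m (V3 *t V4)) =
  \sum_k (Normc.normc (u k))%:C *:
    (at_qubit a (V1 *m pauli R k *m V3) *t
     (phase (u k) *: at_qubit b (V2 *m pauli R k *m V4))).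
Proof.
rewrite mulmx_sumr mulmx_suml.
under eq_bigr do rewrite -scalemxAr -scalemxAl !tensmx_mul.
rewrite gate_on_sum; apply: eq_bigr => k _.
by rewrite tensmxZr scalerA -phaseE gate_on_tens.
Qed.

End Overhead.

(* The gates may share qubits: a and b need not be injective. *)
Theorem theorem6p4 (R : realType) (nA nB N : nat)
    (leNA : (N <= nA)%N) (leNB : (N <= nB)%N)
    (a : 'I_N -> 'I_nA) (b : 'I_N -> 'I_nB)
    (U : 'I_N -> 'M[R[i]]_(2 * 2)) (u : 'I_N -> 'I_4 -> R[i])
    (unitaryU : forall j, U j \is unitarymx)
    (KAK : forall j, is_KAK (U j) (u j)) :
  let E := fun j : 'I_N => conj_channel (gate_on (a j) (b j) (U j)) in
  let w := fun k : {ffun 'I_N -> 'I_4} => \prod_(j < N) u j (k j) in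
  let v := 1 + 2 * \sum_k \sum_(k' | k' != k)
                     Normc.normc (w k) * Normc.normc (w k') in
  is_bb_gamma (@LOCC R) E v /\ is_bb_gamma (@LO R) E v.
Proof.
move=> E w v.
have ex j : exists V : 'M[R[i]]_2 * 'M[R[i]]_2 * 'M[R[i]]_2 * 'M[R[i]]_2,
    [/\ V.1.1.1 \is unitarymx, V.1.1.2 \is unitarymx, V.1.2 \is unitarymx,
      V.2 \is unitarymx
    & U j = (V.1.1.1 *t V.1.1.2) *m
      (\sum_k u j k *: (pauli R k *t pauli R k)) *m (V.1.2 *t V.2)].
  by have [_ [V1 [V2 [V3 [V4 VU]]]]] := KAK j; exists (V1, V2, V3, V4).
have [V VU] := fin_all_exists ex.
pose r j k := Normc.normc (u j k).
pose S j k := at_qubit (a j) ((V j).1.1.1 *m pauli R k *m (V j).1.2).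
pose T j k := phase (u j k) *: at_qubit (b j) ((V j).1.1.2 *m pauli R k *m (V j).2).
have eE j : E j = conj_channel (\sum_k (r j k)%:C *: (S j k *t T j k)).
  by rewrite /E; have [_ _ _ _ ->] := VU j; rewrite gate_on_KAK.
have r0 j k : 0 <= r j k by rewrite -ler0c -[(r j k)%:C]/(`|u j k|).
have uS j k : S j k \is unitarymx.
  have [uV1 _ uV3 _ _] := VU j; apply: at_qubit_unitary.
  exact: mul_unitarymx (mul_unitarymx uV1 (pauli_unitary R k)) uV3.
have uT j k : T j k \is unitarymx.
  have [_ uV2 _ uV4 _] := VU j; apply/unitarymxP.
  rewrite adjmxZ -scalemxAr -scalemxAl scalerA mulrC -normCK phase_norm expr1n.
  rewrite scale1r; apply/unitarymxP/at_qubit_unitary.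
  exact: mul_unitarymx (mul_unitarymx uV2 (pauli_unitary R k)) uV4.
(* The sum over strings factors into one sum per gate, each equal to 1 by the KAK normalization. *)
have r1 : \sum_(k : {ffun 'I_N -> 'I_4}) (\prod_j r j (k j)) ^+ 2 = 1.
  under eq_bigr do rewrite -prodrXl.
  rewrite -(bigA_distr_bigA (fun j k => r j k ^+ 2)) big1 // => j _.
  by case: (KAK j).
have vE : v = 1 + 2 * \sum_(k : {ffun 'I_N -> 'I_4}) \sum_(k' | k' != k)
    (\prod_j r j (k j)) * (\prod_j r j (k' j)).
  rewrite /v; congr (_ + _ * _); apply: eq_bigr => k _; apply: eq_bigr => k' _.
  by rewrite /w !normc_prod.
have [P uP orthP] := interleaving_unitaries leNA
  (fun j => let: And5 h _ _ _ _ := VU j in h) (fun j => let: And5 _ _ h _ _ := VU j in h)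
  (fun _ _ => normr1 _) (fun j k => esym (scale1r (S j k))).
have [Q uQ orthQ] := interleaving_unitaries leNB
  (fun j => let: And5 _ h _ _ _ := VU j in h) (fun j => let: And5 _ _ _ h _ := VU j in h)
  (fun j k => phase_norm (u j k)) (fun j k => erefl (T j k)).
have lower eA eB m (c : 'I_m -> R) F :
    bb_decomposition (@LOCC R) E (eA := eA) (eB := eB) c F -> v <= \sum_i `|c i|.
  move=> dec; rewrite vE.
  have := LOCC_decomposition_lower_bound (qdim_gt0 nA) (qdim_gt0 nB) r0 r1 uP uQ
    orthP orthQ eE dec.
  (* As the squares add up to 1, twice the squared sum is 2 plus twice the off-diagonal sum, which
     turns the bound into [v]. *)
  rewrite sqr_sum_offdiag r1 mulrDr mulr1; set s := 2 * _; set t := \sum_i _.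
  by lra.
have [eA [eB [m [c [F [dec sumc]]]]]] := LO_overhead r0 r1 uS uT eE.
rewrite -vE in sumc.
have mono eA' eB' m' (c' : 'I_m' -> R) F' :=
  @bb_decomposition_mono R (@LO R) (@LOCC R) _ _ _ E eA' eB' m' c' F' (@LO_LOCC R).
split; split.
- by exists eA, eB, m, c, F; split=> //; apply: mono.
- exact: lower.
- by exists eA, eB, m, c, F.
- by move=> eA' eB' m' c' F' /mono; apply: lower.
Qed.
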